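(* Fix $t\in\mathbb{N}$ with $t\le T$, and let $\phi_{t,T}:\mathcal{R}_{t,T}^{\infty}\to L^{\infty}(\mathcal{F}_t)$ be a law invariant, concave monetary utility function (the time-$t$ member of a monetary utility process) which is continuous for bounded decreasing sequences. Let $\Psi_{t,T}(X):=-\phi_{t,T}(-X)$ be its insurance version, and let $X^1,\dots,X^n\in\mathcal{R}_{t,T}^{\infty}$ be fixed. Then: (i) $\displaystyle {\rm ess}\sup_{\tilde X^i\sim X^i,\ i=1,\dots,n}\Psi_{t,T}\Big(\frac1n\sum_{i=1}^n\tilde X^i\Big)={\rm ess}\sup_{a\in D_{t,T}}F_{t,T}(a)$, where the left-hand supremum runs over all $\tilde X^1,\dots,\tilde X^n\in\mathcal{R}_{t,T}^{\infty}$ with $\tilde X^i\sim X^i$. (ii) If $a^0\in D_{t,T}$ is a worst scenario of $F_{t,T}$, and $\bar X^1,\dots,\bar X^n\in\mathcal{R}_{t,T}^{\infty}$ with $\bar X^i\sim X^i$ are $a^0$-comonotone, then $(\bar X^1,\dots,\bar X^n)$ is a worst case portfolio of $\Psi_{t,T}$, i.e. ${\rm ess}\sup_{\tilde X^i\sim X^i}\Psi_{t,T}\big(\frac1n\sum_{i=1}^n\tilde X^i\big)=\Psi_{t,T}\big(\frac1n\sum_{i=1}^n\bar X^i\big)$.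
   Context: Let $(\Omega,\mathcal{F},(\mathcal{F}_s)_{s\in\mathbb{N}},P)$ be a filtered probability space with $\mathcal{F}_0=\{\emptyset,\Omega\}$; (in)equalities between random variables/processes hold $P$-a.s.; $T\in\mathbb{N}$ is a fixed horizon. $\mathcal{R}^0$ is the space of adapted processes, $\mathcal{R}^\infty=\{X\in\mathcal{R}^0:\exists m,\ \sup_s|X_s|\le m\}$. $A^1$ is the set of adapted $a$ with $E\sum_{s}|\Delta a_s|<\infty$, where $a_{-1}=0$, $\Delta a_s=a_s-a_{s-1}$; $A^1_+=\{a\in A^1:\Delta a_s\ge0\ \forall s\}$. For $t\le T$, $\pi_{t,T}(X)_s=1_{\{t\le s\}}X_{s\wedge T}$, $\mathcal{R}^\infty_{t,T}=\pi_{t,T}(\mathcal{R}^\infty)$, $A^1_{t,T}=\pi_{t,T}A^1$, and for $X\in\mathcal{R}^\infty$, $a\in A^1$: $\langle X,a\rangle_{t,T}=E\big(\sum_{s=t}^{T}X_s\Delta a_s\mid\mathcal{F}_t\big)$. $D_{t,T}=\{a\in\pi_{t,T}A^1_+:\langle 1,a\rangle_{t,T}=1\}$. A monetary utility function on $\mathcal{R}^\infty_{t,T}$ is a map $\phi:\mathcal{R}^\infty_{t,T}\to L^\infty(\mathcal{F}_t)$ with $\phi(1_AX)=1_A\phi(X)$ for $A\in\mathcal{F}_t$, $\phi(X)\le\phi(Y)$ if $X\le Y$, and $\phi(X+m1_{[t,\infty)})=\phi(X)+m$ for $m\in L^\infty(\mathcal{F}_t)$. It is concave if $\phi(\lambda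 X+(1-\lambda)Y)\ge\lambda\phi(X)+(1-\lambda)\phi(Y)$ for $\lambda\in L^\infty(\mathcal{F}_t)$, $0\le\lambda\le1$; continuous for bounded decreasing sequences if $\phi(X^k)\to\phi(X)$ whenever $(X^k)\subset\mathcal{R}^\infty_{t,T}$ is decreasing with $X^k_s\to X_s$ for all $s$, $X\in\mathcal{R}^\infty_{t,T}$. Its acceptance set is $\mathcal{C}_\phi=\{X:\phi(X)\ge0\}$ and $\phi^{\#}(a)={\rm ess}\inf_{X\in\mathcal{C}_\phi}\langle X,a\rangle_{t,T}$ for $a\in A^1_{t,T}$. A process $X\in\mathcal{R}^\infty_{t,T}$ is identified with the random vector $(X_t,\dots,X_T)$; $X\sim X'$ means equal joint laws; $\phi$ is law invariant if $\phi(X)=\phi(X')$ whenever $X\sim X'$. For $a\in D_{t,T}$: $\Psi_a(\hat X)={\rm ess}\sup_{\tilde X\sim\hat X,\ \tilde X\in\mathcal{R}^\infty_{t,T}}\langle\tilde X,a\rangle_{t,T}$. The average risk function is $F_{t,T}(a)=\frac1n\sum_{i=1}^n\Psi_a(X^i)+\phi_{t,T}^{\#}(a)$, $a\in D_{t,T}$; $a^0$ is a worst scenario of $F_{t,T}$ if $F_{t,T}(a^0)={\rm ess}\sup_{a\in D_{t,T}}F_{t,T}(a)$. Processes $\tilde X^i\sim X^i$ are $a^0$-comonotone if $\Psi_{a^0}(\tilde X^i)=\langle\tilde X^i,a^0\rangle_{t,T}$ for each $i$ and $\Psi_{a^0}(\sum_i\tilde X^i)=\langle\sum_i\tilde X^i,a^0\rangle_{t,T}$.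 *)

(* Defs.v *)
From HB Require Import structures.
From mathcomp Require Import all_boot all_order all_algebra.
From mathcomp Require Import all_classical all_reals all_analysis.
From mathcomp Require Import measurable_realfun.
Set Implicit Arguments. Unset Strict Implicit. Unset Printing Implicit Defensive.
Import Order.TTheory GRing.Theory Num.Theory.
Import numFieldNormedType.Exports.
Local Open Scope classical_set_scope.
Local Open Scope ring_scope.

Section Defs.
Context {d : measure_display} {T : measurableType d} {R : realType}.
Variable P : probability T R.

Definition process := nat -> T -> R.

Definition Gmeas (G : set (set T)) (f : T -> R) :=
  forall B : set R, measurable B -> G (f @^-1` B).

Definition filtration (F : nat -> set (set T)) :=
  [/\ (forall s, sigma_algebra setT (F s)),
      (forall s, F s `<=` measurable),
      (forall s, F s `<=` F s.+1) &
      F 0%N = [set A | A = set0 \/ A = setT]].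

Variable F : nat -> set (set T).

Definition adapted (X : process) := forall s, Gmeas (F s) (X s).

Definition Rinf (X : process) :=
  adapted X /\ exists m : R, {ae P, forall x, forall s, `|X s x| <= m}.

Definition pi_tT (t TT : nat) (X : process) : process :=
  fun s x => if (t <= s)%N then X (minn s TT) x else 0.

Definition Rinf_tT t TT := [set X | exists Y, Rinf Y /\ X = pi_tT t TT Y].

Definition delta (a : process) (s : nat) (x : T) : R :=
  a s x - (if s is s'.+1 then a s' x else 0).

Definition A1 (a : process) :=
  adapted a /\
  (\int[P]_x (\sum_(0 <= s <oo) (`|delta a s x|)%:E) < +oo)%E.

Definition A1plus (a : process) :=
  A1 a /\ forall s, {ae P, forall x, 0 <= delta a s x}.

(** conditional expectation E(Z | G): a chosen version (it exists for
    integrable Z by Radon-Nikodym); fallback 0 otherwise *)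
Definition is_condexp (G : set (set T)) (Z Y : T -> R) :=
  [/\ Gmeas G Y, P.-integrable setT (EFin \o Y) &
      forall A, G A ->
        (\int[P]_(x in A) (Y x)%:E = \int[P]_(x in A) (Z x)%:E)%E].

Definition condexp (G : set (set T)) (Z : T -> R) : T -> R :=
  match pselect (exists Y, is_condexp G Z Y) with
  | left h => projT1 (cid h)
  | right _ => fun _ => 0
  end.

Definition pairing (t TT : nat) (X a : process) : T -> R :=
  condexp (F t) (fun x => \sum_(t <= s < TT.+1) X s x * delta a s x).

Definition D_tT (t TT : nat) : set process :=
  [set a | (exists a', A1plus a' /\ a = pi_tT t TT a') /\
           {ae P, forall x, pairing t TT (fun _ _ => 1) a x = 1}].

(** equality of the joint laws of (X_t,...,X_T) and (Y_t,...,Y_T): the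
    sigma-algebra on paths generated by the measurable rectangles in the
    coordinates t..T is the product Borel sigma-algebra of R^{T-t+1} *)
Definition rect_sets (t TT : nat) : set (set (nat -> R)) :=
  [set C | exists B : nat -> set R, (forall s, measurable (B s)) /\
     C = [set f | forall s, (t <= s <= TT)%N -> B s (f s)]].

Definition same_law (t TT : nat) (X Y : process) :=
  forall C, <<s setT, rect_sets t TT>> C ->
    P [set x | C (fun s => X s x)] = P [set x | C (fun s => Y s x)].

Definition is_esssup (S : set (T -> \bar R)) (Z : T -> \bar R) :=
  [/\ measurable_fun setT Z,
      (forall Y, S Y -> {ae P, forall x, (Y x <= Z x)%E}) &
      (forall Z', measurable_fun setT Z' ->
         (forall Y, S Y -> {ae P, forall x, (Y x <= Z' x)%E}) ->
         {ae P, forall x, (Z x <= Z' x)%E})].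

Definition esssup (S : set (T -> \bar R)) : T -> \bar R :=
  match pselect (exists Z, is_esssup S Z) with
  | left h => projT1 (cid h)
  | right _ => fun _ => -oo%E
  end.

Definition essinf (S : set (T -> \bar R)) : T -> \bar R :=
  fun x => (- esssup [set (fun y => - Y y)%E | Y in S] x)%E.

Definition monetary_utility (t TT : nat) (phi : process -> T -> R) :=
  [/\ (forall X, Rinf_tT t TT X ->
         Gmeas (F t) (phi X) /\ exists m : R, {ae P, forall x, `|phi X x| <= m}),
      (forall (A : set T) X, F t A -> Rinf_tT t TT X ->
         {ae P, forall x, phi (fun s y => \1_A y * X s y) x = \1_A x * phi X x}),
      (forall X Y, Rinf_tT t TT X -> Rinf_tT t TT Y ->
         {ae P, forall x, forall s, X s x <= Y s x} ->
         {ae P, forall x, phi X x <= phi Y x}) &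
      (forall X (m : T -> R), Rinf_tT t TT X -> Gmeas (F t) m ->
         (exists c : R, {ae P, forall x, `|m x| <= c}) ->
         {ae P, forall x,
            phi (fun s y => X s y + (if (t <= s)%N then m y else 0)) x
            = phi X x + m x})].

Definition concave_mu (t TT : nat) (phi : process -> T -> R) :=
  forall X Y (lam : T -> R), Rinf_tT t TT X -> Rinf_tT t TT Y ->
    Gmeas (F t) lam -> {ae P, forall x, 0 <= lam x <= 1} ->
    {ae P, forall x,
       lam x * phi X x + (1 - lam x) * phi Y x
       <= phi (fun s y => lam y * X s y + (1 - lam y) * Y s y) x}.

Definition law_invariant (t TT : nat) (phi : process -> T -> R) :=
  forall X Y, Rinf_tT t TT X -> Rinf_tT t TT Y -> same_law t TT X Y ->
    {ae P, forall x, phi X x = phi Y x}.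

Definition cont_bdd_decr (t TT : nat) (phi : process -> T -> R) :=
  forall (Xk : nat -> process) (X : process),
    (forall k, Rinf_tT t TT (Xk k)) -> Rinf_tT t TT X ->
    (forall k, {ae P, forall x, forall s, Xk k.+1 s x <= Xk k s x}) ->
    {ae P, forall x, forall s, ((fun k => Xk k s x) : R^nat) @ \oo --> X s x} ->
    {ae P, forall x, ((fun k => phi (Xk k) x) : R^nat) @ \oo --> phi X x}.

Definition Psi_ins (phi : process -> T -> R) (X : process) : T -> R :=
  fun x => - phi (fun s y => - X s y) x.

Definition Psi_a (t TT : nat) (a Xhat : process) : T -> \bar R :=
  esssup [set (fun x => (pairing t TT Xt a x)%:E) |
          Xt in [set Xt | Rinf_tT t TT Xt /\ same_law t TT Xt Xhat]].

Definition accept (t TT : nat) (phi : process -> T -> R) : set process :=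
  [set X | Rinf_tT t TT X /\ {ae P, forall x, 0 <= phi X x}].

Definition phi_sharp (t TT : nat) (phi : process -> T -> R) (a : process)
  : T -> \bar R :=
  essinf [set (fun x => (pairing t TT X a x)%:E) | X in accept t TT phi].

Definition avg_risk (t TT : nat) (phi : process -> T -> R) (n : nat)
  (X : 'I_n -> process) (a : process) : T -> \bar R :=
  fun x => ((n%:R^-1)%:E * (\sum_(i < n) Psi_a t TT a (X i) x)
            + phi_sharp t TT phi a x)%E.

Definition worst_scenario (t TT : nat) (phi : process -> T -> R) (n : nat)
  (X : 'I_n -> process) (a0 : process) :=
  D_tT t TT a0 /\
  {ae P, forall x, avg_risk t TT phi X a0 x
     = esssup [set avg_risk t TT phi X a | a in D_tT t TT] x}.

Definition sum_proc (n : nat) (X : 'I_n -> process) : process :=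
  fun s x => \sum_(i < n) X i s x.

Definition avg_proc (n : nat) (X : 'I_n -> process) : process :=
  fun s x => n%:R^-1 * \sum_(i < n) X i s x.

Definition comonotone (t TT : nat) (n : nat) (a0 : process)
  (Xt : 'I_n -> process) :=
  (forall i, {ae P, forall x,
      Psi_a t TT a0 (Xt i) x = (pairing t TT (Xt i) a0 x)%:E}) /\
  {ae P, forall x,
      Psi_a t TT a0 (sum_proc Xt) x = (pairing t TT (sum_proc Xt) a0 x)%:E}.

Definition worst_family (t TT : nat) (phi : process -> T -> R) (n : nat)
  (X : 'I_n -> process) : set (T -> \bar R) :=
  [set (fun x => (Psi_ins phi (avg_proc Xt) x)%:E) |
     Xt in [set Xt : 'I_n -> process |
              forall i, Rinf_tT t TT (Xt i) /\ same_law t TT (Xt i) (X i)]].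

End Defs.

(* Main.v *)
(** Weak duality, [<Y, a> + phi#(a) <= Psi(Y)], follows by testing [phi#] on
    shifted positions, and it gives (ii) and the inequality [>=] of (i), because
    the essential suprema over the laws of the [X i] split into separate suprema.

    For [<=] one needs, for every position [X] and [eps > 0], a scenario [a] in
    [D_tT] which is dual-optimal for [X] up to an error of expectation [eps].
    Bounded adapted processes are bounded measurable functions on [nat * T] with
    the optional sigma-algebra, and [U |-> E (phi (X + U) - phi X)] is concave
    there and has the Fatou property.  Such a functional [h] has an
    [eps]-supergradient in [L^1].  Indeed, if [h <= e] on the ball [B_r] of
    [L^oo], then on [B_2r] the functional [h], penalised by a large multiple of
    the squared [L^2]-distance to [B_r], is at most [e + eta]; the first-order
    condition at a near-maximiser yields an integrable [W] of [L^1]-norm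
    [O(e / r)] with [h U - E (U W) <= e + O(eta)] on [B_2r].  Iterating along
    [r = e 2^k], the corrections are summable in [L^1].  The supergradient is
    automatically positive of conditional mass one, by monotonicity and cash
    invariance, hence the increment of a process in [D_tT]; locality and pasting
    of acceptable positions turn the scalar bound into the conditional one. *)

Require Import Defs.
From HB Require Import structures.
From mathcomp Require Import all_boot all_order all_algebra.
From mathcomp Require Import all_classical all_reals all_analysis.
From mathcomp Require Import measurable_realfun.
From mathcomp Require Import ring lra.
Import Order.TTheory GRing.Theory Num.Theory.
Import numFieldNormedType.Exports.
Local Open Scope classical_set_scope.
Local Open Scope ring_scope.
Set Implicit Arguments. Unset Strict Implicit. Unset Printing Implicit Defensive.

(** * Integrable functions on a finite measure space *)

(** The obstacle is that separation in [L^oo] yields only finitely additive functionals, while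
    scenarios are integrable processes. Semicontinuity is available only along bounded a.e.
    convergent sequences, hence on one ball at a time, so the supergradient is built ball by ball.
    The scheme can start because monotonicity and cash invariance give [h <= r] on [B_r]: on the
    ball of radius [e] the zero density already errs by at most [e]. The corrections for the doubled
    radii then have [L^1]-norms of order [2^-k]. The final error enters the dual inequality only as
    an additive constant; scaling the test positions by an arbitrary factor removes it from the
    constraints, so positivity and normalisation of the scenario hold exactly. It remains in the
    value of the utility, but with arbitrarily small expectation, which is enough for an almost sure
    comparison of essential suprema. *)

Section L1_tools.
Context {d : measure_display} {T : measurableType d} {R : realType}.
Context {mu : {finite_measure set T -> \bar R}}.
Implicit Types (f g U V : T -> R) (r : R).

(** The bound holds at every point, not a.e., so these [L^oo]-balls do not refer to a measure; a.e.
    bounded functions enter them after [clip]. *)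
Definition bounded_mfun r f := measurable_fun setT f /\ forall x, `|f x| <= r.

Local Notation L1 f := (mu.-integrable setT (EFin \o f)).

Lemma L1_measurable f : L1 f -> measurable_fun setT f.
Proof. by move=> /measurable_int/measurable_EFinP. Qed.

Lemma bounded_mfun_le r r' f : r <= r' -> bounded_mfun r f -> bounded_mfun r' f.
Proof. by move=> rr' [mf bf]; split=> // x; apply: le_trans rr'. Qed.

Lemma bounded_mfun_ge0 r f : bounded_mfun r f -> 0 <= r.
Proof. by case=> _ /(_ point); apply: le_trans. Qed.

Lemma bounded_mfun_cst r : bounded_mfun `|r| (cst r).
Proof. by split. Qed.

Lemma bounded_mfunD r s f g : bounded_mfun r f -> bounded_mfun s g ->
  bounded_mfun (r + s) (fun x => f x + g x).
Proof.
move=> [mf bf] [mg bg]; split; first exact: measurable_funD.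
by move=> x; rewrite (le_trans (ler_normD _ _))// lerD.
Qed.

Lemma bounded_mfunZ r f c : bounded_mfun r f ->
  bounded_mfun (`|c| * r) (fun x => c * f x).
Proof.
move=> [mf bf]; split; first exact: measurable_funM.
by move=> x; rewrite normrM ler_wpM2l.
Qed.

Lemma bounded_mfun_conv r f g c : 0 <= c <= 1 ->
  bounded_mfun r f -> bounded_mfun r g ->
  bounded_mfun r (fun x => c * f x + (1 - c) * g x).
Proof.
move=> /andP[c0 c1] [mf bf] [mg bg]; split.
  by apply: measurable_funD; apply: measurable_funM.
move=> x; rewrite (le_trans (ler_normD _ _))// !normrM ger0_norm// (@ger0_norm _ (1 - c))
  ?subr_ge0//.
have -> : r = c * r + (1 - c) * r by ring.
by rewrite lerD// ler_wpM2l ?subr_ge0.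
Qed.

Lemma bounded_mfunM r s f g : bounded_mfun r f -> bounded_mfun s g ->
  bounded_mfun (r * s) (fun x => f x * g x).
Proof.
move=> [mf bf] [mg bg]; split; first exact: measurable_funM.
by move=> x; rewrite normrM ler_pM.
Qed.

Lemma L1_bounded r f : bounded_mfun r f -> L1 f.
Proof.
move=> [mf bf]; apply: measurable_bounded_integrable => //.
  exact: fin_num_fun_lty.
exists r; split; first exact: num_real.
by move=> s rs x _; exact: le_trans (bf x) (ltW rs).
Qed.

Lemma L1_le f g : measurable_fun setT f -> L1 g ->
  (forall x, `|f x| <= `|g x|) -> L1 f.
Proof.
move=> mf ig fg; apply: le_integrable ig => //; first exact/measurable_EFinP.
by move=> x _; rewrite lee_fin fg.
Qed.

Lemma L1D f g : L1 f -> L1 g -> L1 (fun x => f x + g x).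
Proof. by move=> *; rewrite (_ : _ \o _ = (EFin \o f) \+ (EFin \o g))//; exact: integrableD. Qed.

Lemma L1Z f c : L1 f -> L1 (fun x => c * f x).
Proof. by move=> h; exact: (integrableZl measurableT c h). Qed.

Lemma L1B f g : L1 f -> L1 g -> L1 (fun x => f x - g x).
Proof.
move=> hf hg; have := L1D hf (L1Z (-1) hg).
by under eq_fun do rewrite mulN1r.
Qed.

Lemma L1_abs f : L1 f -> L1 (fun x => `|f x|).
Proof. exact: integrable_norm. Qed.

Lemma L1M r f g : bounded_mfun r f -> L1 g -> L1 (fun x => f x * g x).
Proof.
move=> bf ig; apply: (@L1_le _ (fun x => r * g x)).
- by apply: measurable_funM; [case: bf|exact: L1_measurable].
- exact: L1Z.
- move=> x; rewrite !normrM ler_wpM2r//.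
  by case: bf => _ /(_ x) h; rewrite (le_trans h)// ler_norm.
Qed.

Lemma L1_sum I (s : seq I) (F : I -> T -> R) : (forall i, L1 (F i)) ->
  L1 (fun x => \sum_(i <- s) F i x).
Proof.
move=> h; rewrite (_ : _ \o _ = fun x => (\sum_(i <- s) (F i x)%:E)%E); last first.
  by apply/funext => x /=; rewrite sumEFin.
by apply: integrable_sum => // i _; exact: h.
Qed.

Lemma Rintegral_sum I (s : seq I) (F : I -> T -> R) : (forall i, L1 (F i)) ->
  \int[mu]_x (\sum_(i <- s) F i x) = \sum_(i <- s) \int[mu]_x F i x.
Proof.
move=> h; elim: s => [|i s ih].
  by under eq_Rintegral do rewrite big_nil; rewrite big_nil Rintegral_cst// mul0r.
under eq_Rintegral do rewrite big_cons.
by rewrite RintegralD// ?ih ?big_cons//; exact: L1_sum.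
Qed.

Lemma Rintegral_ae_le f g : L1 f -> L1 g -> {ae mu, forall x, f x <= g x} ->
  \int[mu]_x f x <= \int[mu]_x g x.
Proof.
move=> lf lg fg; rewrite -subr_ge0 -RintegralB//.
have mh : measurable_fun setT (fun x => g x - f x) by apply: L1_measurable; exact: L1B.
rewrite /Rintegral (ae_eq_integral (fun x => (Num.max 0 (g x - f x))%:E))//.
- by apply: fine_ge0; apply: integral_ge0 => x _; rewrite lee_fin le_max lexx.
- exact/measurable_EFinP.
- by apply/measurable_EFinP; apply: measurable_maxr.
- apply: filterS fg => x fg _ /=.
  by rewrite max_r// subr_ge0.
Qed.

Lemma Rintegral_ae_eq f g : L1 f -> L1 g -> {ae mu, forall x, f x = g x} ->
  \int[mu]_x f x = \int[mu]_x g x.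
Proof.
move=> lf lg fg; apply/eqP; rewrite eq_le !Rintegral_ae_le//;
  by apply: filterS fg => x ->.
Qed.

Lemma EFin_Rintegral f : L1 f -> (\int[mu]_x f x)%:E = (\int[mu]_x (f x)%:E)%E.
Proof. by move=> h; rewrite /Rintegral fineK//; exact: integrable_fin_num. Qed.

Lemma Rintegral_dominated (F : nat -> T -> R) f (g : T -> \bar R) :
  (forall n, measurable_fun setT (F n)) -> measurable_fun setT f ->
  {ae mu, forall x, F n x @[n --> \oo] --> f x} -> mu.-integrable setT g ->
  {ae mu, forall x, forall n, (`|F n x|%:E <= g x)%E} ->
  [/\ L1 f, (\int[mu]_x `|F n x - f x|) @[n --> \oo] --> (0 : R) &
     (\int[mu]_x F n x) @[n --> \oo] --> \int[mu]_x f x].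
Proof.
move=> mF mf Ff ig Fg.
have LF n : L1 (F n).
  apply/integrableP; split; first exact/measurable_EFinP.
  move/integrableP : (ig) => [_]; apply: le_lt_trans.
  apply: ae_ge0_le_integral => //.
  - by apply/measurable_EFinP; exact: measurableT_comp.
  - by apply: measurableT_comp => //; exact: measurable_int ig.
  - by apply: filterS Fg => x /(_ n) h _; rewrite (le_trans h)// lee_abs.
have [] := @dominated_convergence _ _ _ mu setT measurableT (fun n x => (F n x)%:E)
   (EFin \o f) g.
- by move=> n; exact/measurable_EFinP.
- exact/measurable_EFinP.
- by apply: filterS Ff => x h _ /=; apply/cvg_EFin => //; exact: nearW.
- by [].
- by apply: filterS Fg => x h n _; exact: h.
move=> Lf c1 c2; split => //.
- exact: (fine_cvg c1).
- by apply: fine_cvg; rewrite EFin_Rintegral.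
Qed.

(** The first term plus the series of absolute increments is an integrable majorant, so the
    telescoping series converges a.e. and dominated convergence applies. *)
Lemma L1_cvg_of_summable_increments (F : nat -> T -> R) (C : R) :
  (forall j, L1 (F j)) ->
  (forall j, \int[mu]_x `|F j.+1 x - F j x| <= C / 2 ^+ j) ->
  exists f, [/\ L1 f, {ae mu, forall x, F n x @[n --> \oo] --> f x} &
    (\int[mu]_x `|F n x - f x|) @[n --> \oo] --> (0 : R)].
Proof.
move=> LF FC.
pose D j x := `|F j.+1 x - F j x|.
have D0 j x : 0 <= D j x by exact: normr_ge0.
have LD j : L1 (D j) by apply/L1_abs/L1B.
have mD j : measurable_fun setT (EFin \o D j) by apply/measurable_EFinP; exact: L1_measurable.
pose G x := (\sum_(0 <= j <oo) (D j x)%:E)%E.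
have G0 x : (0 <= G x)%E by apply: nneseries_ge0 => n _ _; rewrite lee_fin D0.
have mG : measurable_fun setT G.
  by apply: (@ge0_emeasurable_sum _ _ _ _ (fun j x => (D j x)%:E) xpredT);
    [move=> k x _ _; rewrite lee_fin D0|move=> k _; exact: mD].
have iG : mu.-integrable setT G.
  apply/integrableP; split => //.
  under eq_integral do rewrite gee0_abs//.
  rewrite integral_nneseries//; last by move=> n x _; rewrite lee_fin D0.
  apply: (@le_lt_trans _ _ (2 * C)%:E); last exact: ltry.
  have C0 : 0 <= C.
    have := FC 0%N; rewrite expr0 divr1; apply: le_trans.
    exact: Rintegral_ge0.
  apply: lime_le.
    by apply: is_cvg_nneseries => n _ _; apply: integral_ge0 => x _; rewrite lee_fin D0.
  apply: nearW => n.
  under eq_bigr do rewrite -EFin_Rintegral//.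
  rewrite sumEFin lee_fin.
  apply: (@le_trans _ _ (\sum_(0 <= j < n) C / 2 ^+ j)).
    by apply: ler_sum => j _; exact: FC.
  suff -> : \sum_(0 <= j < n) C / 2 ^+ j = 2 * C - 2 * (C / 2 ^+ n).
    by rewrite gerBl mulr_ge0// divr_ge0// exprn_ge0.
  elim: n => [|n ih]; first by rewrite big_nil expr0 divr1 subrr.
  rewrite big_nat_recr//= ih exprS invfM; field.
  by rewrite expf_neq0.
have aeG : {ae mu, forall x, (G x < +oo)%E}.
  have := integrable_ae measurableT iG; apply: filterS => x /(_ I).
  by rewrite ge0_fin_numE.
have FE n x : F n x = F 0%N x + \sum_(0 <= j < n) (F j.+1 x - F j x).
  by rewrite (GRing.telescope_sumr (F ^~ x))// addrC subrK.
have cF x : (G x < +oo)%E -> cvgn (F ^~ x).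
  move=> Gx; have := nnseries_is_cvg (u := D ^~ x) (fun i => normr_ge0 _) Gx.
  move=> /normed_cvg cs.
  rewrite (_ : F ^~ x = fun n => F 0%N x + series (fun j => F j.+1 x - F j x) n).
    by apply: is_cvgD => //; exact: is_cvg_cst.
  by apply/funext => n; exact: FE.
(* The upper limit is measurable as it stands and agrees with the limit wherever the series of
   increments is finite. *)
pose f x := fine (limn_esup (fun n => (F n x)%:E)).
have mf : measurable_fun setT f.
  apply: measurableT_comp => //; apply: measurable_fun_limn_esup => n.
  by apply/measurable_EFinP; exact: L1_measurable.
have Ff : {ae mu, forall x, F n x @[n --> \oo] --> f x}.
  apply: filterS aeG => x /cF cx.
  rewrite /f is_cvg_limn_esupE; last first.
    apply/cvg_ex; exists (limn (F ^~ x))%:E.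
    by apply/cvg_EFin => //; exact: nearW.
  by rewrite EFin_lim.
have ig : mu.-integrable setT (fun x => `|F 0%N x|%:E + G x)%E.
  by apply: integrableD => //; exact: L1_abs.
have [] := Rintegral_dominated (fun n => L1_measurable (LF n)) mf Ff ig.
  apply: aeW => x n; rewrite FE.
  apply: (@le_trans _ _ (`|F 0%N x| + \sum_(0 <= j < n) D j x)%:E).
    rewrite lee_fin (le_trans (ler_normD _ _))// lerD2l.
    exact: ler_norm_sum.
  rewrite EFinD leeD2l// -sumEFin.
  by apply: nneseries_lim_ge => k _ _; rewrite lee_fin D0.
by move=> Lf cf _; exists f; split.
Qed.

End L1_tools.

(** * Integrable supergradients of Fatou concave functionals *)

Section truncation.
Context {R : realType}.
Implicit Types r y u : R.

Definition clip r y := Num.max (- r) (Num.min r y).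

Lemma clip_bound r y : 0 <= r -> - r <= clip r y <= r.
Proof. by move=> r0; rewrite /clip le_max lexx/= ge_max ge_min lexx/= andbT; lra. Qed.

Lemma clip_id r y : `|y| <= r -> clip r y = y.
Proof. by rewrite ler_norml => /andP[? ?]; rewrite /clip min_r// max_r. Qed.

Variant clip_spec r y : R -> Type :=
  | ClipHi of r <= y : clip_spec r y r
  | ClipLo of y <= - r : clip_spec r y (- r)
  | ClipMid of - r <= y <= r : clip_spec r y y.

Lemma clipP r y : 0 <= r -> clip_spec r y (clip r y).
Proof.
move=> r0; rewrite /clip; case: (leP r y) => ry.
  by rewrite max_r; [exact: ClipHi|lra].
case: (leP (- r) y) => ry'; first by apply: ClipMid; rewrite ry' ltW.
by apply: ClipLo; exact: ltW.
Qed.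

(** Truncation is the nearest-point projection onto [[- r, r]], so it realises the [L^2]-distance to
    the ball pointwise. *)
Lemma clip_dist r y u : 0 <= r -> `|u| <= r -> (y - clip r y) ^+ 2 <= (y - u) ^+ 2.
Proof.
move=> r0; rewrite ler_norml => /andP[u1 u2]; rewrite -subr_ge0.
case: clipP => // [ry|ry|_]; last by rewrite subrr expr0n/= subr0 sqr_ge0.
- rewrite [X in 0 <= X](_ : _ = (r - u) * ((y - u) + (y - r))); last by ring.
  by apply: mulr_ge0; lra.
- rewrite [X in 0 <= X](_ : _ = (u + r) * ((u - y) + (- r - y))); last by ring.
  by apply: mulr_ge0; lra.
Qed.

(** Where the difference is nonzero, [y] has the same sign and modulus at least [r]. This turns a
    bound on the pairing of [Y] with the gradient into an [L^1] bound on the gradient. *)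
Lemma clip_norm r y : 0 <= r -> r * `|y - clip r y| <= y * (y - clip r y).
Proof.
move=> r0; case: clipP => // [ry|ry|_]; last by rewrite subrr normr0 !mulr0.
- by rewrite ger0_norm ?subr_ge0// ler_wpM2r// subr_ge0.
- by rewrite ler0_norm; nra.
Qed.

Lemma clip_sqr r y : 0 <= r -> (y - clip r y) ^+ 2 <= y * (y - clip r y).
Proof. by move=> r0; case: clipP => // *; nra. Qed.

End truncation.

(** * Nested bounded convex sets and a.e. convergence of near-minimal elements *)

Section nested_convex_sets.
Context {d : measure_display} {T : measurableType d} {R : realType}.
Context {mu : {finite_measure set T -> \bar R}}.
Implicit Types (f g U V W Z : T -> R) (r : R) (h : (T -> R) -> R).

Local Notation L1 f := (mu.-integrable setT (EFin \o f)).

Lemma measurable_clip r f : measurable_fun setT f ->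
  measurable_fun setT (fun x => clip r (f x)).
Proof. by move=> mf; apply: measurable_maxr => //; exact: measurable_minr. Qed.

Lemma bounded_mfun_clip r f : 0 <= r -> measurable_fun setT f ->
  bounded_mfun r (fun x => clip r (f x)).
Proof.
move=> r0 mf; split; first exact: measurable_clip.
by move=> x; rewrite ler_norml clip_bound.
Qed.

(** An a.e. limit of functions bounded by [r] is a.e. bounded by [r]; clipping it gives a version
    bounded everywhere. *)
Lemma ae_cvg_clip r (F : nat -> T -> R) f : 0 <= r ->
  (forall n x, `|F n x| <= r) ->
  {ae mu, forall x, F n x @[n --> \oo] --> f x} ->
  {ae mu, forall x, F n x @[n --> \oo] --> clip r (f x)}.
Proof.
move=> r0 Fr; apply: filterS => x Fx; rewrite clip_id//.
have cx : cvgn (fun n => `|F n x|) by apply: is_cvg_norm; apply/cvg_ex; eexists; exact: Fx.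
have -> : `|f x| = limn (fun n => `|F n x|).
  by apply/esym/cvg_lim => //; exact: cvg_norm.
by apply: limr_le => //; exact: nearW.
Qed.

(* Near-minimisers of the L^2 norm in the K n are Cauchy by the parallelogram
   identity, which replaces a weak compactness argument. *)
Lemma nested_convex_ae_cvg (K : nat -> set (T -> R)) r :
  (forall n U, K n U -> bounded_mfun r U) ->
  (forall n, K n.+1 `<=` K n) ->
  (forall n U V, K n U -> K n V ->
     K n (fun x => 2^-1 * U x + (1 - 2^-1) * V x)) ->
  (forall n, K n !=set0) ->
  exists (U_ : nat -> T -> R) U, [/\ forall n, K n (U_ n), bounded_mfun r U &
    {ae mu, forall x, U_ n x @[n --> \oo] --> U x}].
Proof.
move=> Kb Knest Kconv K0.
have r0 : 0 <= r by have [U /Kb/bounded_mfun_ge0] := K0 0%N.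
pose q U := \int[mu]_x (U x ^+ 2).
have Lsq U : bounded_mfun r U -> L1 (fun x => U x ^+ 2).
  by move=> bU; apply: (@L1_bounded _ _ _ _ (r * r)); exact: bounded_mfunM.
have q0 U : 0 <= q U by apply: Rintegral_ge0 => x _; rewrite sqr_ge0.
have mono m n : (m <= n)%N -> K n `<=` K m.
  elim: n => [|n ih]; first by rewrite leqn0 => /eqP ->.
  by rewrite leq_eqVlt => /predU1P[->//|]; rewrite ltnS => /ih h U /Knest /h.
pose v n := inf (q @` K n).
have hi n : has_inf (q @` K n).
  split; first by have [U KU] := K0 n; exists (q U); exists U.
  by exists 0 => _ [U _ <-].
have v_le n U : K n U -> v n <= q U.
  by move=> KU; apply: ge_inf; [have [] := hi n|exists U].
have v_mono m n : (m <= n)%N -> v m <= v n.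
  move=> mn; apply: lb_le_inf; first by have [] := hi n.
  by move=> _ [U /(mono _ _ mn) KU <-]; exact: v_le.
pose M := r ^+ 2 * fine (mu setT).
have qM U : bounded_mfun r U -> q U <= M.
  move=> bU; rewrite /M -Rintegral_cst//; apply: le_Rintegral => //.
  - exact: Lsq.
  - exact: L1_bounded (bounded_mfun_cst _).
  - by move=> x _; rewrite -[U x ^+ 2]ger0_norm ?sqr_ge0// normrX lerXn2r ?nnegrE//; case: bU.
have hs : has_sup (range v).
  split; first by exists (v 0%N); exists 0%N.
  exists M => _ [n _ <-]; have [U KU] := K0 n.
  by rewrite (le_trans (v_le _ _ KU))// qM//; exact: Kb KU.
pose vs := sup (range v).
have v_vs n : v n <= vs by apply: ub_le_sup; [have [] := hs|exists n].
have e0 j : 0 < (4 ^+ j)^-1 :> R by rewrite invr_gt0 exprn_gt0.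
have exU j : exists NU : nat * (T -> R), [/\ (j <= NU.1)%N, K NU.1 NU.2,
    vs - (4 ^+ j)^-1 <= v NU.1 & q NU.2 <= vs + (4 ^+ j)^-1].
  have [_ [n _ <-] vn] := sup_adherent (e0 j) hs.
  (* The index is at least [j] and late enough for [v] to be within [(4 ^+ j)^-1] of its
     supremum. *)
  pose N := maxn j n.
  have [_ [U KU <-] qU] := inf_adherent (e0 j) (hi N).
  exists (N, U); split => //=; first exact: leq_maxl.
  - by rewrite (le_trans (ltW vn))// v_mono// leq_maxr.
  - by apply: le_trans (ltW qU) _; rewrite lerD2r; exact: v_vs.
have /choice[NU NUP] := exU.
pose U_ j := (NU j).2.
have KU j : K (NU j).1 (U_ j) by case: (NUP j).
have bU j : bounded_mfun r (U_ j) by exact: Kb (KU j).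
have e4 j : (4 ^+ j.+1)^-1 <= (4 ^+ j)^-1 :> R.
  by rewrite lef_pV2 ?posrE ?exprn_gt0// ler_eXn2l ?ltr1n.
(* Both iterates lie in [K N] for the smaller index [N], hence so does their midpoint [m], and [q m]
   cannot be much below [vs]. With [x = (4 ^+ j)^-1] the parallelogram identity gives
   [4 (vs + x) - 4 (vs - x) = 8 x]. *)
have dq j : \int[mu]_x (U_ j.+1 x - U_ j x) ^+ 2 <= 8 * (4 ^+ j)^-1.
  pose N := minn (NU j.+1).1 (NU j).1.
  pose m x := 2^-1 * U_ j.+1 x + (1 - 2^-1) * U_ j x.
  have Km : K N m.
    by apply: Kconv; [apply: mono (KU j.+1); exact: geq_minl|apply: mono (KU j); exact: geq_minr].
  have vN : vs - (4 ^+ j)^-1 <= v N.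
    rewrite /N /minn; case: ifPn => _.
      by case: (NUP j.+1) => _ _ h _; rewrite (le_trans _ h)// lerD2l lerN2.
    by case: (NUP j) => _ _ h _.
  have qm : vs - (4 ^+ j)^-1 <= q m by rewrite (le_trans vN)// v_le.
  have q1 : q (U_ j.+1) <= vs + (4 ^+ j)^-1.
    by case: (NUP j.+1) => _ _ _ h; rewrite (le_trans h)// lerD2l.
  have q2 : q (U_ j) <= vs + (4 ^+ j)^-1 by case: (NUP j).
  have bm : bounded_mfun r m by apply: bounded_mfun_conv => //; lra.
  have -> : \int[mu]_x (U_ j.+1 x - U_ j x) ^+ 2 =
      2 * q (U_ j.+1) + 2 * q (U_ j) - 4 * q m.
    rewrite /q -!RintegralZl ?Lsq// -RintegralD ?L1Z ?Lsq// -RintegralB ?L1Z ?L1D ?Lsq ?L1Z ?Lsq//.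
    by apply: eq_Rintegral => x _; rewrite /m; field.
  lra.
have [f [Lf Uf _]] : exists f, [/\ L1 f, {ae mu, forall x, U_ n x @[n --> \oo] --> f x} &
    (\int[mu]_x `|U_ n x - f x|) @[n --> \oo] --> (0 : R)].
  (* Integrating [|D| <= (2^j D^2 + 2^-j) / 2] with the bound [8 / 4^j] for [D^2] leaves [4 / 2^j]
     plus half the total mass over [2^j]. The tolerance [4^-j] was chosen to make this summable. *)
  apply: (@L1_cvg_of_summable_increments _ _ _ _ _ (4 + fine (mu setT))).
    by move=> j; exact: L1_bounded (bU j).
  move=> j; set D := fun x => U_ j.+1 x - U_ j x.
  have bD : bounded_mfun (r + r) D.
    by split; [apply: measurable_funB; [case: (bU j.+1)|case: (bU j)]|
       move=> x; rewrite (le_trans (ler_normB _ _))// lerD//; [case: (bU j.+1)|case: (bU j)]].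
  have p2 : 0 < 2 ^+ j :> R by exact: exprn_gt0.
  have LD2 : L1 (fun x => D x ^+ 2) by apply: (@L1_bounded _ _ _ _ ((r + r) * (r + r)));
    exact: bounded_mfunM.
  have Lc : L1 (fun=> (2 ^+ j)^-1 : R) by exact: L1_bounded (bounded_mfun_cst _).
  apply: (@le_trans _ _ (\int[mu]_x (2^-1 * (2 ^+ j * D x ^+ 2 + (2 ^+ j)^-1)))).
    apply: le_Rintegral => //.
    - exact/L1_abs/(L1_bounded bD).
    - by apply/L1Z/L1D => //; exact: L1Z.
    move=> x _; rewrite -[D x ^+ 2]ger0_norm ?sqr_ge0// normrX.
    (* AM-GM *)
    have := sqr_ge0 (2 ^+ j * `|D x| - 1).
    have i2 : 2 ^+ j * (2 ^+ j)^-1 = 1 :> R by rewrite divff// gt_eqF.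
    have i0 : 0 < (2 ^+ j)^-1 :> R by rewrite invr_gt0.
    move: (2 ^+ j) (2 ^+ j)^-1 `|D x| i2 i0 p2 => a b y ab b0 a0 h.
    have : 0 <= b * (a * y - 1) ^+ 2 by rewrite mulr_ge0// ltW.
    have -> : b * (a * y - 1) ^+ 2 = (a * b) * a * y ^+ 2 - 2 * (a * b) * y + b by ring.
    by rewrite ab; lra.
  rewrite RintegralZl; [|by []|by apply: L1D => //; exact: L1Z].
  rewrite RintegralD//; last exact: L1Z.
  rewrite RintegralZl// Rintegral_cst//.
  have := dq j; rewrite -/D => dqj.
  have : 2 ^+ j * (\int[mu]_x D x ^+ 2) <= 8 / 2 ^+ j.
    apply: (@le_trans _ _ (2 ^+ j * (8 * (4 ^+ j)^-1))); first by rewrite ler_wpM2l// ltW.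
    rewrite (_ : 4 = 2 * 2 :> R); last by ring.
    suff -> : 2 ^+ j * (8 * ((2 * 2) ^+ j)^-1) = 8 / 2 ^+ j :> R by [].
    by rewrite exprMn; field; rewrite gt_eqF.
  have : 0 <= fine (mu setT) by rewrite fine_ge0.
  have : 0 < (2 ^+ j)^-1 :> R by rewrite invr_gt0.
  move: (2 ^+ j)^-1 (fine _) (2 ^+ j * _) => a m y; nra.
exists U_, (fun x => clip r (f x)); split.
- by move=> n; apply: mono (KU n); case: (NUP n).
- by apply: bounded_mfun_clip => //; exact: L1_measurable Lf.
- by apply: ae_cvg_clip => // n x; case: (bU n).
Qed.

End nested_convex_sets.

(** * Extending an upper bound from a ball to the ball of twice the radius *)

Section usc_extension.
Context {d : measure_display} {T : measurableType d} {R : realType}.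
Context {mu : {finite_measure set T -> \bar R}}.
Implicit Types (f g U V W Z : T -> R) (r : R) (h : (T -> R) -> R).

Local Notation L1 f := (mu.-integrable setT (EFin \o f)).

Definition concave_fun h := forall r c U V, 0 <= c <= 1 ->
  bounded_mfun r U -> bounded_mfun r V ->
  c * h U + (1 - c) * h V <= h (fun x => c * U x + (1 - c) * V x).

(** Superlevel sets are closed under bounded a.e. convergence. Constant sequences show that such an
    [h] does not distinguish bounded functions that agree a.e. *)
Definition fatou_usc h := forall r (U_ : nat -> T -> R) U c,
  (forall n, bounded_mfun r (U_ n)) -> bounded_mfun r U ->
  {ae mu, forall x, U_ n x @[n --> \oo] --> U x} ->
  (forall n, c <= h (U_ n)) -> c <= h U.

Let dist2 r U := \int[mu]_x (U x - clip r (U x)) ^+ 2.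

Lemma bounded_mfun_dist r s U : 0 <= r -> bounded_mfun s U ->
  bounded_mfun (s + r) (fun x => U x - clip r (U x)).
Proof.
move=> r0 [mU bU]; split; first by apply: measurable_funB => //; exact: measurable_clip.
move=> x; rewrite (le_trans (ler_normB _ _))// lerD// ler_norml.
exact: clip_bound.
Qed.

Lemma L1_sqr s U : bounded_mfun s U -> L1 (fun x => U x ^+ 2).
Proof. by move=> bU; exact: L1_bounded (bounded_mfunM bU bU). Qed.

Lemma Rintegral_eq0_ae f : L1 f -> (forall x, 0 <= f x) ->
  \int[mu]_x f x = 0 -> {ae mu, forall x, f x = 0}.
Proof.
move=> Lf f0 If; have /(ae_eq_integral_abs mu measurableT) : measurable_fun setT (EFin \o f).
  exact: measurable_int Lf.
move=> [+ _].
have -> : (\int[mu]_x `|(EFin \o f) x| = 0)%E.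
  under eq_integral do rewrite /= ger0_norm//.
  by rewrite -EFin_Rintegral// If.
by move=> /(_ erefl); apply: filterS => x /(_ I) [].
Qed.

(** Otherwise the functions of [B_s] within squared distance [1/(n+1)] of [B_r] and with value at
    least [e + eta] form nested nonempty convex sets. An a.e. limit of their elements is a.e. in
    [B_r] and still has value at least [e + eta]. *)
Lemma fatou_usc_near_ball h (r s e eta : R) : 0 < r -> r <= s ->
  concave_fun h -> fatou_usc h ->
  (forall U, bounded_mfun r U -> h U <= e) -> 0 < eta ->
  exists2 del : R, 0 < del &
    forall U, bounded_mfun s U -> dist2 r U <= del -> h U <= e + eta.
Proof.
move=> r0 rs hconc husc he eta0; apply: contrapT => nex.
pose K n := [set U | [/\ bounded_mfun s U, dist2 r U <= n.+1%:R^-1 & e + eta <= h U]].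
have r0' := ltW r0.
have Ld U : bounded_mfun s U -> L1 (fun x => (U x - clip r (U x)) ^+ 2).
  by move=> bU; exact: L1_sqr (bounded_mfun_dist r0' bU).
have [] := @nested_convex_ae_cvg _ _ _ mu K s.
- by move=> n U [].
- move=> n U [bU dU hU]; split => //; apply: le_trans dU _.
  by rewrite lef_pV2 ?posrE ?ltr0n// ler_nat.
- move=> n U V [bU dU hU] [bV dV hV].
  have c01 : 0 <= (2^-1 : R) <= 1 by lra.
  have bm := bounded_mfun_conv c01 bU bV.
  split => //; last first.
    by apply: le_trans (hconc _ _ _ _ c01 bU bV); lra.
  apply: (@le_trans _ _ (2^-1 * dist2 r U + 2^-1 * dist2 r V)); last first.
    by move: (dist2 r U) (dist2 r V) (n.+1%:R^-1) dU dV => a b c; lra.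
  rewrite /dist2 -!RintegralZl ?Ld// -RintegralD ?L1Z ?Ld//.
  apply: le_Rintegral; rewrite ?Ld ?L1D ?L1Z ?Ld//.
  move=> x _; set u := U x; set v := V x.
  (* The average of the two truncations is again in [[- r, r]], so it competes with the truncation
     of the average. *)
  apply: le_trans (_ : (2^-1 * u + (1 - 2^-1) * v - (2^-1 * clip r u + (1 - 2^-1) * clip r
    v)) ^+ 2 <= _).
    apply: clip_dist => //; rewrite ler_norml.
    by have := clip_bound u r0'; have := clip_bound v r0'; lra.
  move: (clip r u) (clip r v) => a b; rewrite -subr_ge0.
  by rewrite [X in 0 <= X](_ : _ = (2^-1 * ((u - a) - (v - b))) ^+ 2) ?sqr_ge0//; field.
- move=> n; apply: contrapT => nK; apply: nex; exists n.+1%:R^-1.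
    by rewrite invr_gt0 ltr0n.
  move=> U bU dU; rewrite leNgt; apply/negP => hU; apply: nK; exists U.
  by split => //; exact: ltW.
move=> U_ [U [KU bU UU]].
have bU_ n : bounded_mfun s (U_ n) by case: (KU n).
have bUU n : bounded_mfun (s + s) (fun x => U_ n x - U x).
  have [m1 b1] := bU_ n; have [m2 b2] := bU; split; first exact: measurable_funB.
  by move=> x; rewrite (le_trans (ler_normB _ _))// lerD.
have [_ _ cv] : [/\ L1 (fun=> 0 : R),
    (\int[mu]_x `|(U_ n x - U x) ^+ 2 - 0|) @[n --> \oo] --> (0 : R) &
    (\int[mu]_x ((U_ n x - U x) ^+ 2)) @[n --> \oo] --> \int[mu]_x (0 : R)].
  apply: (@Rintegral_dominated _ _ _ _ _ _ (fun=> ((s + s) * (s + s))%:E)).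
  - by move=> n; have [] := bounded_mfunM (bUU n) (bUU n).
  - exact: measurable_cst.
  - apply: filterS UU => x Ux.
    have c0 : (U_ n x - U x) @[n --> \oo] --> (0 : R).
      by rewrite -(subrr (U x)); apply: cvgB => //; exact: cvg_cst.
    by have := cvgM c0 c0; rewrite mulr0; exact.
  - exact: (L1_bounded (bounded_mfun_cst _)).
  - by apply: aeW => x n; rewrite lee_fin; have [_ /(_ x)] := bounded_mfunM (bUU n) (bUU n).
rewrite Rintegral_cst// mul0r in cv.
have dU0 : dist2 r U = 0.
  apply/eqP; rewrite eq_le; apply/andP; split; last first.
    by apply: Rintegral_ge0 => x _; rewrite sqr_ge0.
  (* Vanishing majorant of [dist2 r U]: twice the squared [L^2]-distance from [U] to [U_ n], plus
     twice the bound on the squared distance from [U_ n] to the ball. *)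
  have cv2 : (2 * (\int[mu]_x ((U_ n x - U x) ^+ 2)) + 2 * n.+1%:R^-1) @[n --> \oo] --> (0 : R).
    have c2 : (2 : R) @[n --> \oo] --> (2 : R) by exact: cvg_cst.
    have := cvgD (cvgM c2 cv) (cvgM c2 (@cvg_harmonic R)).
    by rewrite !mulr0 addr0; exact.
  rewrite -[leRHS](cvg_lim _ cv2)//; apply: limr_ge; first exact: cvgP cv2.
  apply: nearW => n.
  have [_ dn _] := KU n.
  apply: (@le_trans _ _ (2 * (\int[mu]_x ((U_ n x - U x) ^+ 2)) + 2 * dist2 r (U_ n))); last first.
    by rewrite lerD2l ler_pM2l.
  rewrite /dist2 -!RintegralZl ?Ld ?(L1_sqr (bUU n))//.
  rewrite -RintegralD ?L1Z ?Ld ?(L1_sqr (bUU n))//.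
  apply: le_Rintegral; rewrite ?Ld ?L1D ?L1Z ?Ld ?(L1_sqr (bUU n))//.
  move=> x _; apply: le_trans (clip_dist (U x) r0' (_ : `|clip r (U_ n x)| <= r)) _.
    by rewrite ler_norml clip_bound.
  move=> /=; move: (U x) (U_ n x) (clip r (U_ n x)) => u v a; rewrite -subr_ge0.
  by rewrite [X in 0 <= X](_ : _ = ((v - u) + (v - a)) ^+ 2 ) ?sqr_ge0//; ring.
have Uc : {ae mu, forall x, U x = clip r (U x)}.
  have := Rintegral_eq0_ae (Ld _ bU) (fun x => sqr_ge0 _) dU0.
  by apply: filterS => x /eqP; rewrite sqrf_eq0 subr_eq0 => /eqP.
have bc : bounded_mfun r (fun x => clip r (U x)).
  by apply: bounded_mfun_clip => //; case: bU.
have : e + eta <= h (fun x => clip r (U x)).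
  apply: (husc s U_) => //; first exact: bounded_mfun_le bc.
  - by apply: filterS2 UU Uc => x + <-.
  - by move=> n; case: (KU n).
by have := he _ bc; lra.
Qed.

(* One step of the gluing: W is the gradient of lam/2 * dist(., B_r)^2 at a
   near-maximiser of h - lam/2 * dist(., B_r)^2 over B_2r. *)
Lemma fatou_usc_extend_bound h (r e e' : R) : 0 < r -> 0 <= e -> e < e' ->
  concave_fun h -> fatou_usc h -> 0 <= h (fun _ : T => 0) ->
  (forall U, bounded_mfun r U -> h U <= e) ->
  exists W, [/\ exists s, bounded_mfun s W,
    \int[mu]_x `|W x| <= 2 * e' / r &
    forall U, bounded_mfun (2 * r) U -> h U - \int[mu]_x (U x * W x) <= e'].
Proof.
move=> r0 e0 ee' hconc husc h0 he.
(* Three losses of [eta] add up to [e']: one in the bound on [J], one from near-maximality, one from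
   the second-order term. *)
pose eta := (e' - e) / 3.
have eta0 : 0 < eta by rewrite /eta; lra.
have r0' := ltW r0.
have [del del0 hdel] := @fatou_usc_near_ball h r (2 * r) e eta r0 ltac:(lra) hconc husc he eta0.
have b0 (s : R) : 0 <= s -> bounded_mfun s (fun _ : T => 0 : R).
  by move=> s0; apply: bounded_mfun_le (bounded_mfun_cst _); rewrite normr0.
(* Concavity between [U] and 0: [U / 2] lies in [B_r], where [h <= e]. *)
have h2e U : bounded_mfun (2 * r) U -> h U <= 2 * e.
  move=> bU; have c01 : 0 <= (2^-1 : R) <= 1 by lra.
  have := hconc _ _ _ _ c01 bU (b0 (2 * r) ltac:(lra)).
  rewrite (_ : (fun x => _ + _) = fun x => 2^-1 * U x); last first.
    by apply/funext => x; rewrite mulr0 addr0.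
  have bU2 : bounded_mfun r (fun x => 2^-1 * U x).
    by apply: bounded_mfun_le (bounded_mfunZ _ bU); rewrite ger0_norm; lra.
  by have := he _ bU2; lra.
(* The penalty at squared distance [del] is then [2 * e], the bound for [h] on the large ball, so
   [J] is at most 0 beyond [del]. *)
pose lam := 4 * e / del.
have lam0 : 0 <= lam by apply: divr_ge0; [exact: mulr_ge0|exact: ltW].
pose J U := h U - lam / 2 * dist2 r U.
have d0 U : 0 <= dist2 r U by apply: Rintegral_ge0 => x _; rewrite sqr_ge0.
have Jle U : bounded_mfun (2 * r) U -> J U <= e + eta.
  move=> bU; rewrite /J; have [dU|dU] := leP (dist2 r U) del.
    have := hdel _ bU dU; have : 0 <= lam / 2 * dist2 r U by rewrite mulr_ge0// divr_ge0.
    lra.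
  have : lam / 2 * del <= lam / 2 * dist2 r U.
    by apply: ler_wpM2l; [exact: divr_ge0|exact: ltW].
  have -> : lam / 2 * del = 2 * e by rewrite /lam; field; rewrite gt_eqF.
  have := h2e _ bU; lra.
pose S := [set J U | U in [set U | bounded_mfun (2 * r) U]].
have hS : has_sup S.
  split; first by exists (J (fun=> 0)); exists (fun=> 0) => //; apply: b0; lra.
  by exists (e + eta) => _ [U bU <-]; exact: Jle.
pose m := sup S.
have Jm U : bounded_mfun (2 * r) U -> J U <= m.
  by move=> bU; apply: ub_le_sup; [case: hS|exists U].
(* Second-order coefficient of the penalty: two points of [B_2r] differ by at most [4 * r], whence
   [16 * r ^+ 2]. *)
pose C := lam / 2 * (16 * r ^+ 2 * fine (mu setT)).
have C0 : 0 <= C by do ![apply: mulr_ge0 => //]; rewrite ?sqr_ge0 ?fine_ge0.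
pose th := Num.min 1 (eta / (C + 1)).
have th0 : 0 < th by rewrite lt_min ltr01/= divr_gt0//; lra.
have th1 : th <= 1 by rewrite ge_min lexx.
have thC : th * C <= eta.
  apply: (@le_trans _ _ (eta / (C + 1) * C)); first by rewrite ler_wpM2r// ge_min lexx orbT.
  by rewrite mulrAC ler_pdivrMr; nra.
(* The gap is [th * eta] because the comparison along the segment from [Y] towards [U] is divided by
   the step [th] at the end. *)
have [_ [Y bY <-] JY] := sup_adherent (mulr_gt0 th0 eta0) hS.
rewrite -/m in JY.
pose D x := Y x - clip r (Y x).
have bD : bounded_mfun (2 * r + r) D by exact: bounded_mfun_dist.
have LYD : L1 (fun x => Y x * D x) by exact: L1M bY (L1_bounded bD).
pose W x := lam * D x.
have bW : bounded_mfun (`|lam| * (2 * r + r)) W by exact: bounded_mfunZ.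
have YW : \int[mu]_x (Y x * W x) = lam * \int[mu]_x (Y x * D x).
  by rewrite -RintegralZl//; apply: eq_Rintegral => x _; rewrite /W; ring.
have YD : dist2 r Y <= \int[mu]_x (Y x * D x).
  apply: le_Rintegral => //; first exact: L1_sqr bD.
  by move=> x _; exact: clip_sqr.
have grad U : bounded_mfun (2 * r) U ->
    h U - \int[mu]_x (U x * W x) <= h Y - \int[mu]_x (Y x * W x) + 2 * eta.
  move=> bU.
  have c01 : 0 <= th <= 1 by rewrite th1 ltW.
  pose V x := th * U x + (1 - th) * Y x.
  have bV : bounded_mfun (2 * r) V by exact: bounded_mfun_conv.
  have JV := Jm _ bV.
  have hV := hconc _ _ _ _ c01 bU bY.
  rewrite -/V in hV.
  have LUD : L1 (fun x => U x * D x) by exact: L1M bU (L1_bounded bD).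
  have UW : \int[mu]_x (U x * W x) = lam * \int[mu]_x (U x * D x).
    by rewrite -RintegralZl//; apply: eq_Rintegral => x _; rewrite /W; ring.
  (* The projection of [V] is replaced by that of [Y], another point of the ball. This can only
     raise the distance, and it leaves an explicit quadratic in [th] instead of a derivative. *)
  have dV : dist2 r V <= dist2 r Y + 2 * th * ((\int[mu]_x (U x * D x)) - \int[mu]_x (Y x * D x))
       + th ^+ 2 * (16 * r ^+ 2 * fine (mu setT)).
    have Lc : L1 (fun=> 16 * r ^+ 2 : R) by exact: L1_bounded (bounded_mfun_cst _).
    have LD2 : L1 (fun x => (Y x - clip r (Y x)) ^+ 2) by exact: L1_sqr bD.
    have LB := L1B LUD LYD.
    rewrite -(Rintegral_cst mu measurableT) -RintegralB// -!RintegralZl//.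
    have LB' := L1Z (2 * th) LB; have Lc' := L1Z (th ^+ 2) Lc.
    have LS := L1D LD2 LB'.
    rewrite /dist2 -RintegralD// -RintegralD//.
    apply: le_Rintegral => //; [|exact: L1D|].
      exact: L1_sqr (bounded_mfun_dist r0' bV).
    move=> x _; apply: le_trans (clip_dist (V x) r0' (_ : `|clip r (Y x)| <= r)) _.
      by rewrite ler_norml clip_bound.
    have -> : V x - clip r (Y x) = D x + th * (U x - Y x) by rewrite /V /D; ring.
    rewrite -/(D x) -subr_ge0.
    rewrite [X in 0 <= X](_ : _ = th ^+ 2 * (16 * r ^+ 2 - (U x - Y x) ^+ 2)); last by ring.
    rewrite mulr_ge0 ?sqr_ge0// subr_ge0.
    have [_ /(_ x)] := bU; have [_ /(_ x)] := bY; rewrite !ler_norml; nra.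
  rewrite UW YW.
  have : lam / 2 * dist2 r V <= lam / 2 * (dist2 r Y + 2 * th * ((\int[mu]_x (U x * D x)) -
    \int[mu]_x (Y x * D x))
       + th ^+ 2 * (16 * r ^+ 2 * fine (mu setT))) by rewrite ler_wpM2l// divr_ge0.
  rewrite !mulrDr.
  have -> : lam / 2 * (th ^+ 2 * (16 * r ^+ 2 * fine (mu setT))) = th * (th * C)
    by rewrite /C; ring.
  have : th * (th * C) <= th * eta by rewrite ler_pM2l.
  move: JV JY; rewrite /J.
  move: (\int[mu]_x (U x * D x)) (\int[mu]_x (Y x * D x)) hV => u y hV JV JY tC dV'.
  rewrite -(ler_pM2l th0); nra.
have YWle : h Y - \int[mu]_x (Y x * W x) <= e + eta.
  apply: le_trans (Jle _ bY); rewrite /J lerD2l lerN2 YW.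
  by have : lam * dist2 r Y <= lam * \int[mu]_x (Y x * D x) by [rewrite ler_wpM2l];
    have := mulr_ge0 lam0 (d0 Y); lra.
exists W; split; first by exists (`|lam| * (2 * r + r)).
- rewrite ler_pdivlMr// mulrC -RintegralZl//; last exact/L1_abs/(L1_bounded bW).
  apply: (@le_trans _ _ (\int[mu]_x (Y x * W x))).
    apply: le_Rintegral => //.
    - exact/L1Z/L1_abs/(L1_bounded bW).
    - exact: L1M bY (L1_bounded bW).
    move=> x _; rewrite /W normrM (ger0_norm lam0) mulrCA [leRHS]mulrCA ler_wpM2l//.
    exact: clip_norm.
  (* At [U = 0], where [h] is nonnegative, the gradient inequality bounds the integral of [Y * W] by
     [h Y + 2 * eta]. *)
  have := grad _ (b0 (2 * r) ltac:(lra)).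
  rewrite (@eq_Rintegral _ _ _ mu setT (fun=> 0)); last by move=> x _; rewrite mul0r.
  rewrite Rintegral_cst// mul0r.
  have := h2e _ bY; rewrite /eta; lra.
- by move=> U /grad h1; apply: le_trans h1 _; move: YWle; rewrite /eta; lra.
Qed.

End usc_extension.
Arguments fatou_usc {d T R} mu h.

(** * Iteration over doubling radii *)

Section L1_supergradient_existence.
Context {d : measure_display} {T : measurableType d} {R : realType}.
Context {mu : {finite_measure set T -> \bar R}}.
Implicit Types (f g U V W Z : T -> R) (r : R) (h : (T -> R) -> R).

Local Notation L1 f := (mu.-integrable setT (EFin \o f)).

Lemma concave_fun_sub_linear h Z : L1 Z -> concave_fun h ->
  concave_fun (fun U => h U - \int[mu]_x (U x * Z x)).
Proof.
move=> LZ hc r c U V c01 bU bV; have := hc _ _ _ _ c01 bU bV.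
have LU := L1M bU LZ; have LV := L1M bV LZ.
have -> : \int[mu]_x ((c * U x + (1 - c) * V x) * Z x) =
    c * \int[mu]_x (U x * Z x) + (1 - c) * \int[mu]_x (V x * Z x).
  rewrite -!RintegralZl// -RintegralD// ?L1Z//.
  by apply: eq_Rintegral => x _; ring.
lra.
Qed.

(** The linear term is continuous along bounded a.e. convergent sequences by dominated convergence;
    passing to a tail makes its error smaller than any [e]. *)
Lemma fatou_usc_sub_linear h Z : L1 Z -> fatou_usc mu h ->
  fatou_usc mu (fun U => h U - \int[mu]_x (U x * Z x)).
Proof.
move=> LZ hu r U_ U c bU_ bU UU hc.
have mZ := L1_measurable LZ.
have [_ _ cv] : [/\ L1 (fun x => U x * Z x),
    (\int[mu]_x `|U_ n x * Z x - U x * Z x|) @[n --> \oo] --> (0 : R) &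
    (\int[mu]_x (U_ n x * Z x)) @[n --> \oo] --> \int[mu]_x (U x * Z x)].
  apply: (@Rintegral_dominated _ _ _ _ _ _ (fun x => (r * `|Z x|)%:E)).
  - by move=> n; apply: measurable_funM => //; case: (bU_ n).
  - by apply: measurable_funM => //; case: bU.
  - by apply: filterS UU => x Ux; apply: cvgM => //; exact: cvg_cst.
  - exact: L1Z (L1_abs LZ).
  - apply: aeW => x n; rewrite lee_fin normrM ler_wpM2r//.
    by case: (bU_ n).
apply/ler_addgt0Pr => e e0.
have /cvgrPdist_le /(_ _ e0) [N _ HN] := cv.
suff : c + \int[mu]_x (U x * Z x) - e <= h U by lra.
apply: (hu r (fun n => U_ (n + N)%N) U) => //.
  by apply: filterS UU => x; rewrite -(cvg_shiftn N).
move=> n; have := hc (n + N)%N; have := HN (n + N)%N (leq_addl _ _).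
by rewrite ler_norml => /andP[]; lra.
Qed.

Theorem fatou_usc_supergradient h (eps : R) : concave_fun h -> fatou_usc mu h ->
  h (fun _ : T => 0) = 0 -> (forall r U, bounded_mfun r U -> h U <= r) ->
  0 < eps ->
  exists2 Z, L1 Z &
    forall r U, bounded_mfun r U -> h U <= eps + \int[mu]_x (U x * Z x).
Proof.
move=> hc hu h0 hr eps0; pose e := eps / 2.
have e0 : 0 < e by rewrite /e; lra.
have p2 k : 0 < 2 ^+ k :> R by exact: exprn_gt0.
(* The error budget starts at [e], for the zero density on the ball of radius [e], and stays below
   [2 * e = eps]. At radius [e * 2 ^+ k] the bound [2 * e' / r] on a correction is at most
   [4 / 2 ^+ k]. *)
pose inv k Z := (exists s, bounded_mfun s Z) /\ forall U,
   bounded_mfun (e * 2 ^+ k) U -> h U - \int[mu]_x (U x * Z x) <= e * (2 - (2 ^+ k)^-1).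
(* The invariant is a premise under the existential, so that choice yields a total successor map. *)
have step (kZ : nat * (T -> R)) : exists Z', inv kZ.1 kZ.2 ->
    inv kZ.1.+1 Z' /\ \int[mu]_x `|Z' x - kZ.2 x| <= 4 / 2 ^+ kZ.1.
  case: kZ => k Z /=; have [[[s bZ] hZ]|] := pselect (inv k Z); last by exists Z.
  have LZ := L1_bounded (mu := mu) bZ.
  have i0 : 0 < (2 ^+ k)^-1 :> R by rewrite invr_gt0.
  have i1 : (2 ^+ k)^-1 <= 1 :> R by rewrite invf_le1// exprn_ege1// ler1n.
  have iS : (2 ^+ k.+1)^-1 = 2^-1 * (2 ^+ k)^-1 :> R by rewrite exprS invfM.
  have [|||||W [[s' bW] IW hW]] := @fatou_usc_extend_bound _ _ _ mu _ (e * 2 ^+ k)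
    (e * (2 - (2 ^+ k)^-1)) (e * (2 - (2 ^+ k.+1)^-1)) _ _ _
    (concave_fun_sub_linear LZ hc) (fatou_usc_sub_linear LZ hu).
  - exact: mulr_gt0.
  - by rewrite mulr_ge0 ?ltW//; lra.
  - by rewrite ltr_pM2l// iS; lra.
  - rewrite (@eq_Rintegral _ _ _ mu setT (fun=> 0)); last by move=> x _; rewrite mul0r.
    by rewrite Rintegral_cst// mul0r subr0 h0.
  - exact: hZ.
  have LW := L1_bounded (mu := mu) bW.
  exists (fun x => Z x + W x) => _; split; first split.
  - by exists (s + s'); exact: bounded_mfunD.
  - move=> U bU; have bU' : bounded_mfun (2 * (e * 2 ^+ k)) U by move: bU; rewrite exprS mulrCA.
    have := hW U bU'.
    have -> : \int[mu]_x (U x * (Z x + W x)) = \int[mu]_x (U x * Z x) + \int[mu]_x (U x * W x).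
      by rewrite -RintegralD ?(L1M bU)//; apply: eq_Rintegral => x _; rewrite mulrDr.
    by rewrite opprD addrA.
  - rewrite (@eq_Rintegral _ _ _ mu setT (fun x => `|W x|)) => [|x _];
    last by rewrite [Z x + _]addrC addrK.
    apply: le_trans IW _; rewrite iS.
    rewrite [leLHS](_ : _ = 2 * (2 - 2^-1 * (2 ^+ k)^-1) / 2 ^+ k); last first.
      by field; rewrite !gt_eqF.
    by rewrite ler_pM2r//; lra.
have /choice[nxt nxtP] := step.
pose Zs := fix Zs k := if k is k'.+1 then nxt (k', Zs k') else (fun=> 0 : R).
have invZ k : inv k (Zs k).
  elim: k => [|k ih]; last by have [] := nxtP (k, Zs k) ih.
  split; first by exists 0; split; [exact: measurable_cst|move=> x; rewrite /= normr0].
  move=> U; rewrite expr0 mulr1 => bU.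
  rewrite (@eq_Rintegral _ _ _ mu setT (fun=> 0)); last by move=> x _; rewrite mulr0.
  by rewrite Rintegral_cst// mul0r invr1; have := hr _ _ bU; lra.
have LZs k : L1 (Zs k) by case: (invZ k) => -[s bZ] _; exact: L1_bounded bZ.
have [Z [LZ _ cZ]] := L1_cvg_of_summable_increments LZs (fun k => (nxtP (k, Zs k) (invZ k)).2).
exists Z => // r U bU.
have r0 := bounded_mfun_ge0 bU.
(* A fixed [U] lies in all balls from some [k0] on, so the bounds pass to the limit in [k]. *)
have [k0 rk0] : exists k0, forall k, (k0 <= k)%N -> r <= e * 2 ^+ k.
  exists (Num.bound (r / e)) => k kk.
  rewrite mulrC -ler_pdivrMr//.
  have := archi_boundP (divr_ge0 r0 (ltW e0)) => /ltW /le_trans; apply.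
  apply: (@le_trans _ _ k%:R); first by rewrite ler_nat.
  by rewrite -natrX ler_nat ltnW// ltn_expl.
have cU : (\int[mu]_x (U x * Zs k x)) @[k --> \oo] --> \int[mu]_x (U x * Z x).
  apply/subr_cvg0; apply: (@squeeze_cvgr _ _ _ _ (fun k => - (r * \int[mu]_x `|Zs k x - Z x|))
     (fun k => r * \int[mu]_x `|Zs k x - Z x|)).
  - apply: nearW => k; rewrite -ler_norml -RintegralB ?(L1M bU)//.
    have LD := L1B (LZs k) LZ.
    apply: (le_trans (le_normr_Rintegral _ _)) => //; first by apply: L1B; exact: L1M bU _.
    rewrite -RintegralZl//; last exact: L1_abs.
    apply: le_Rintegral => //.
    + by apply: L1_abs; apply: L1B; exact: L1M bU _.
    + exact: L1Z (L1_abs _).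
    by move=> x _; rewrite -mulrBr normrM ler_wpM2r//; case: bU.
  - by rewrite -oppr0 -(mulr0 r); apply: cvgN; apply: cvgM => //; exact: cvg_cst.
  - by rewrite -(mulr0 r); apply: cvgM => //; exact: cvg_cst.
have cU' : (eps + \int[mu]_x (U x * Zs k x)) @[k --> \oo] --> eps + \int[mu]_x (U x * Z x).
  by apply: cvgD => //; exact: cvg_cst.
rewrite -(cvg_lim _ cU')//; apply: limr_ge; first exact: cvgP cU'.
exists k0 => // k /= kk; have [_ hZ] := invZ k.
have := hZ U (bounded_mfun_le (rk0 _ kk) bU).
have : e * (2 - (2 ^+ k)^-1) <= e * 2 by rewrite ler_pM2l// gerBl invr_ge0 ltW.
by rewrite /e; lra.
Qed.

End L1_supergradient_existence.

(** * Conditional expectation *)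

Section sub_sigma_algebra.
Context {d : measure_display} {T : measurableType d} {R : realType}.
Variables (G : set (set T)) (hG : sigma_algebra setT G) (GT : G `<=` measurable).

(** Moves [Gmeas] to the measurable type generated by [G], where the closure properties of
    measurable functions apply. *)
Lemma GmeasP (f : T -> R) :
  Gmeas G f <-> measurable_fun setT (f : g_sigma_algebraType G -> R).
Proof.
split => [Gf _ B mB|mf B mB].
  by rewrite setTI measurable_g_measurableTypeE//; exact: Gf.
have := mf measurableT B mB.
by rewrite setTI [X in X _](@measurable_g_measurableTypeE T G hG).
Qed.

Lemma Gmeas_measurable (f : T -> R) : Gmeas G f -> measurable_fun setT f.
Proof. by move=> Gf _ B mB; rewrite setTI; apply: GT; exact: Gf. Qed.

Lemma Gmeas_cst c : Gmeas G (fun=> c : R).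
Proof. by apply/GmeasP; exact: measurable_cst. Qed.

Lemma GmeasD (f g : T -> R) : Gmeas G f -> Gmeas G g -> Gmeas G (fun x => f x + g x).
Proof. by move=> /GmeasP mf /GmeasP mg; apply/GmeasP; exact: measurable_funD. Qed.

Lemma GmeasM (f g : T -> R) : Gmeas G f -> Gmeas G g -> Gmeas G (fun x => f x * g x).
Proof. by move=> /GmeasP mf /GmeasP mg; apply/GmeasP; exact: measurable_funM. Qed.

Lemma GmeasB (f g : T -> R) : Gmeas G f -> Gmeas G g -> Gmeas G (fun x => f x - g x).
Proof. by move=> /GmeasP mf /GmeasP mg; apply/GmeasP; exact: measurable_funB. Qed.

Lemma Gmeas_sum I (s : seq I) (F : I -> T -> R) :
  (forall i, Gmeas G (F i)) -> Gmeas G (fun x => \sum_(i <- s) F i x).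
Proof.
by move=> h; apply/GmeasP; apply: measurable_sum => i; apply/GmeasP.
Qed.

Lemma Gmeas_indic (A : set T) : G A -> Gmeas G (\1_A : T -> R).
Proof.
move=> GA; apply/GmeasP; apply: measurable_indic.
by rewrite measurable_g_measurableTypeE.
Qed.

Lemma G_setC (A : set T) : G A -> G (~` A).
Proof. by move=> GA; rewrite -setTD; have [_ + _] := hG; apply. Qed.

Lemma Gmeas_le (f g : T -> R) : Gmeas G f -> Gmeas G g -> G [set x | f x <= g x].
Proof.
move=> Gf Gg; have := GmeasB Gg Gf.
move=> /(_ `[0, +oo[%classic (measurable_itv _)).
rewrite (_ : _ @^-1` _ = [set x | f x <= g x])//.
by apply/seteqP; split => x /=; rewrite in_itv/= andbT subr_ge0.
Qed.

End sub_sigma_algebra.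

Section condexp.
Context {d : measure_display} {T : measurableType d} {R : realType}.
Variable P : probability T R.
Variables (G : set (set T)) (hG : sigma_algebra setT G) (GT : G `<=` measurable).
Implicit Types Y Z : T -> R.

Local Notation L1 f := (P.-integrable setT (EFin \o f)).
Local Notation TG := (g_sigma_algebraType G).

Lemma measurable_id_sub : measurable_fun setT (id : T -> TG).
Proof.
move=> _ B; rewrite measurable_g_measurableTypeE// => GB.
by rewrite setTI; exact: GT.
Qed.

Let idG_mixin := isMeasurableFun.Build _ _ _ _ _ measurable_id_sub.
Let idG : {mfun T >-> TG} := HB.pack (id : T -> TG) idG_mixin.

(** Radon-Nikodym on the smaller sigma-algebra: the identity pushes forward both [P] and the charge
    with density [Z], and the derivative of the images is the conditional expectation. *)
Lemma condexp_exists Z : L1 Z -> exists Y, is_condexp P G Z Y.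
Proof.
move=> LZ.
pose nuf : {charge set TG -> \bar R} := pushforward (induced_charge LZ) idG.
pose nu : {charge set TG -> \bar R} := nuf measurable_id_sub.
pose mu : probability TG R := distribution P idG.
have numu : nu `<< mu.
  apply/null_content_dominatesP => A mA muA.
  have mA' : measurable (idG @^-1` A) by rewrite -[X in measurable X]setTI;
    exact: measurable_id_sub.
  apply: null_set_integral => //.
  by apply: measurable_funTS; exact: measurable_int LZ.
have mf : measurable_fun setT (Radon_Nikodym nu mu).
  exact: measurable_int (Radon_Nikodym_integrable numu).
pose Y x := fine ((Radon_Nikodym nu mu) x).
have YE : EFin \o Y = Radon_Nikodym nu mu.
  by apply/funext => x /=; rewrite fineK//; exact: Radon_Nikodym_fin_num.
have GY : Gmeas G Y by apply/GmeasP => //; exact: measurableT_comp.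
have mY := Gmeas_measurable GT GY.
have LY : L1 Y.
  apply/integrableP; split; first exact/measurable_EFinP.
  have /integrableP[_] := Radon_Nikodym_integrable numu.
  rewrite (@ge0_integral_distribution _ _ _ _ _ P idG)//; last exact: measurableT_comp.
  by rewrite -YE.
exists Y; split => // A GA.
have mA : measurable (A : set TG) by rewrite measurable_g_measurableTypeE.
have -> : (\int[P]_(x in A) (Z x)%:E = \int[mu]_(x in A) (EFin \o Y) x)%E.
  by rewrite YE -(Radon_Nikodym_integral numu mA).
rewrite /mu /distribution integral_pushforward//.
- by rewrite YE.
- by apply: integrableS LY => //; exact: GT.
Qed.

Lemma condexpP Z : L1 Z -> is_condexp P G Z (condexp P G Z).
Proof.
by move=> /condexp_exists h; rewrite /condexp; case: pselect => // h'; case: cid.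
Qed.

Lemma Gmeas_condexp Z : Gmeas G (condexp P G Z).
Proof.
rewrite /condexp; case: pselect => [h|_]; last exact: Gmeas_cst.
by case: cid => Y [].
Qed.

Lemma bounded_mfun_indic (A : set T) : measurable A -> bounded_mfun 1 (\1_A : T -> R).
Proof.
move=> mA; split; first exact: measurable_indic.
by move=> x; rewrite indicE; case: (_ \in _); rewrite ?normr1 ?normr0.
Qed.

Lemma L1_indic Z (A : set T) : measurable A -> L1 Z -> L1 (fun x => \1_A x * Z x).
Proof. by move=> /bounded_mfun_indic bA; exact: L1M bA. Qed.

Lemma integral_indicE Z (A : set T) : measurable A -> L1 Z ->
  (\int[P]_(x in A) (Z x)%:E)%E = (\int[P]_x (\1_A x * Z x))%:E.
Proof.
move=> mA LZ; rewrite EFin_Rintegral; last exact: L1_indic.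
rewrite integral_mkcond; apply: eq_integral => x _.
rewrite patchE indicE; case: (_ \in _); first by rewrite mul1r.
by rewrite mul0r.
Qed.

Lemma L1_condexp Z : L1 (condexp P G Z).
Proof.
rewrite /condexp; case: pselect => [h|_]; last exact: (@integrable0 _ _ _ P setT).
by case: cid => Y [].
Qed.

Lemma Rintegral_condexp Z (A : set T) : L1 Z -> G A ->
  \int[P]_x (\1_A x * condexp P G Z x) = \int[P]_x (\1_A x * Z x).
Proof.
move=> LZ GA; have [_ LY /(_ _ GA)] := condexpP LZ.
by rewrite !integral_indicE//; [case|exact: GT|exact: GT].
Qed.

(** Testing on the event where [Y1] exceeds [Y2], which belongs to [G], forces the nonnegative
    difference there to have integral zero. *)
Lemma Gmeas_ae_le Y1 Y2 : Gmeas G Y1 -> Gmeas G Y2 -> L1 Y1 -> L1 Y2 ->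
  (forall A, G A -> \int[P]_x (\1_A x * Y1 x) <= \int[P]_x (\1_A x * Y2 x)) ->
  {ae P, forall x, Y1 x <= Y2 x}.
Proof.
move=> G1 G2 L_1 L_2 H; pose A := ~` [set x | Y1 x <= Y2 x].
have GA : G A by apply: G_setC => //; exact: Gmeas_le.
have mA := GT GA.
have L12 : L1 (fun x => \1_A x * Y1 x - \1_A x * Y2 x) by apply: L1B; exact: L1_indic.
have ge0 x : 0 <= \1_A x * Y1 x - \1_A x * Y2 x.
  rewrite indicE -mulrBr; case: (boolP (x \in A)) => [|_]; last by rewrite mul0r.
  by rewrite inE /A /= mul1r subr_ge0 => /negP; rewrite -ltNge => /ltW.
have := Rintegral_eq0_ae L12 ge0; rewrite RintegralB ?L1_indic// => h.
have /h : (\int[P]_x (\1_A x * Y1 x)) - (\int[P]_x (\1_A x * Y2 x)) = 0.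
  apply/eqP; rewrite eq_le subr_le0 H//= -RintegralB ?L1_indic//.
  exact: Rintegral_ge0.
apply: filterS => x; rewrite indicE; case: (boolP (x \in A)); last first.
  by rewrite notin_setE /A /= => /contrapT.
by move=> _; rewrite !mul1r => /eqP; rewrite subr_eq0 => /eqP ->.
Qed.

Lemma condexp_ae_eq Z Y : Gmeas G Y -> L1 Y -> L1 Z ->
  (forall A, G A -> \int[P]_x (\1_A x * Y x) = \int[P]_x (\1_A x * Z x)) ->
  {ae P, forall x, condexp P G Z x = Y x}.
Proof.
move=> GY LY LZ H.
have h1 : {ae P, forall x, condexp P G Z x <= Y x}.
  apply: Gmeas_ae_le => //; [exact: Gmeas_condexp|exact: L1_condexp|].
  by move=> A GA; rewrite Rintegral_condexp// H.
have h2 : {ae P, forall x, Y x <= condexp P G Z x}.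
  apply: Gmeas_ae_le => //; [exact: Gmeas_condexp|exact: L1_condexp|].
  by move=> A GA; rewrite Rintegral_condexp// H.
by apply: filterS2 h1 h2 => x ? ?; apply/eqP; rewrite eq_le; apply/andP.
Qed.

Lemma condexp_ae_congr Z1 Z2 : L1 Z1 -> L1 Z2 -> {ae P, forall x, Z1 x = Z2 x} ->
  {ae P, forall x, condexp P G Z1 x = condexp P G Z2 x}.
Proof.
move=> L_1 L_2 H; apply: condexp_ae_eq => //; [exact: Gmeas_condexp|exact: L1_condexp|].
move=> A GA; have mA := GT GA; rewrite Rintegral_condexp//.
apply: Rintegral_ae_eq; rewrite ?L1_indic//.
by apply: filterS H => x ->.
Qed.

Lemma condexpD Z1 Z2 : L1 Z1 -> L1 Z2 ->
  {ae P, forall x, condexp P G (fun y => Z1 y + Z2 y) x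
     = condexp P G Z1 x + condexp P G Z2 x}.
Proof.
move=> L_1 L_2; apply: condexp_ae_eq.
- by apply: GmeasD => //; exact: Gmeas_condexp.
- by apply: L1D; exact: L1_condexp.
- exact: L1D.
move=> A GA; have mA := GT GA.
have E f g : L1 f -> L1 g -> \int[P]_x (\1_A x * (f x + g x)) =
    (\int[P]_x (\1_A x * f x)) + \int[P]_x (\1_A x * g x).
  move=> Lf Lg; rewrite -RintegralD ?L1_indic//.
  by apply: eq_Rintegral => x _; rewrite mulrDr.
rewrite E; [|exact: L1_condexp|exact: L1_condexp].
by rewrite !Rintegral_condexp// E.
Qed.

Lemma condexpZ c Z : L1 Z ->
  {ae P, forall x, condexp P G (fun y => c * Z y) x = c * condexp P G Z x}.
Proof.
move=> LZ; apply: condexp_ae_eq.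
- by apply: GmeasM => //; [exact: Gmeas_cst|exact: Gmeas_condexp].
- by apply: L1Z; exact: L1_condexp.
- exact: L1Z.
move=> A GA; have mA := GT GA.
have E f : L1 f -> \int[P]_x (\1_A x * (c * f x)) = c * \int[P]_x (\1_A x * f x).
  move=> Lf; rewrite -RintegralZl ?L1_indic//.
  by apply: eq_Rintegral => x _; rewrite mulrCA.
by rewrite !E ?Rintegral_condexp//; exact: L1_condexp.
Qed.

Lemma condexp_indic (B : set T) Z : G B -> L1 Z ->
  {ae P, forall x, condexp P G (fun y => \1_B y * Z y) x = \1_B x * condexp P G Z x}.
Proof.
move=> GB LZ; have mB := GT GB; apply: condexp_ae_eq.
- by apply: GmeasM => //; [exact: Gmeas_indic|exact: Gmeas_condexp].
- by apply: L1_indic => //; exact: L1_condexp.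
- exact: L1_indic.
move=> A GA; have mA := GT GA.
have GAB : G (A `&` B).
  rewrite -[A `&` B]setCK setCI; apply: G_setC => //.
  have := measurable_g_measurableTypeE hG => mE.
  by rewrite -mE; apply: (@measurableU _ TG); rewrite mE; exact: G_setC.
have E f : \int[P]_x (\1_A x * (\1_B x * f x)) = \int[P]_x (\1_(A `&` B) x * f x).
  by apply: eq_Rintegral => x _; rewrite mulrA -[\1_A x * _]/((\1_A \* \1_B) x) -indicI.
by rewrite !E Rintegral_condexp.
Qed.

Lemma condexp0 : {ae P, forall x, condexp P G (fun=> 0) x = 0}.
Proof.
by apply: condexp_ae_eq => //; [exact: Gmeas_cst|exact: (@integrable0 _ _ _ P setT)..].
Qed.

Lemma condexp_sum I (s : seq I) (F : I -> T -> R) : (forall i, L1 (F i)) ->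
  {ae P, forall x, condexp P G (fun y => \sum_(i <- s) F i y) x
     = \sum_(i <- s) condexp P G (F i) x}.
Proof.
move=> LF; elim: s => [|i s ih].
  apply: filterS condexp0 => x h; rewrite big_nil -[RHS]h; congr (condexp P G _ x).
  by apply/funext => y; rewrite big_nil.
have := condexpD (LF i) (L1_sum s LF).
apply: filterS2 ih => x h1 h2; rewrite big_cons -h1 -h2; congr (condexp P G _ x).
by apply/funext => y; rewrite big_cons.
Qed.

End condexp.

(** * Essential suprema *)

Section essential_supremum.
Context {d : measure_display} {T : measurableType d} {R : realType}.
Variable P : probability T R.

Lemma ae_forall_countable (I : countType) (Q : I -> T -> Prop) :
  (forall i, {ae P, forall x, Q i x}) -> {ae P, forall x, forall i, Q i x}.
Proof.
move=> h.
have : {ae P, forall x, forall n, if unpickle n is Some i then Q i x else True}.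
  apply: ae_foralln => n; case: (unpickle n : option I) => [i|]; first exact: h.
  exact: aeW.
by apply: filterS => x hx i; have := hx (pickle i); rewrite pickleK.
Qed.

(** Merging sequences that nearly maximise the probability of a countable union gives a union of
    maximal probability; adjoining one more [A] cannot add mass to it. *)
Lemma essential_union (AA : set (set T)) : AA !=set0 -> AA `<=` measurable ->
  exists A_ : nat -> set T, (forall k, AA (A_ k)) /\
    forall A, AA A -> P (A `\` \bigcup_k A_ k) = 0%E.
Proof.
move=> [A0 AA0] mAA.
pose S := [set fine (P (\bigcup_k A_ k)) | A_ in [set A_ : nat -> set T | forall k, AA (A_ k)]].
have mU (A_ : nat -> set T) : (forall k, AA (A_ k)) -> measurable (\bigcup_k A_ k).
  by move=> h; apply: bigcupT_measurable => k; exact: mAA.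
have fP A : measurable A -> P A \is a fin_num by move=> mA; exact: fin_num_measure.
have hS : has_sup S.
  split; first by exists (fine (P (\bigcup_(k in [set: nat]) A0))); exists (fun=> A0).
  exists 1 => _ [A_ hA <-]; rewrite -lee_fin fineK; last exact/fP/mU.
  exact/probability_le1/mU.
have e0 n : 0 < n.+1%:R^-1 :> R by rewrite invr_gt0 ltr0n.
have /choice[B BP] n : exists A_ : nat -> set T,
    (forall k, AA (A_ k)) /\ sup S - n.+1%:R^-1 < fine (P (\bigcup_k A_ k)).
  by have [_ [A_ hA <-] h] := sup_adherent (e0 n) hS; exists A_.
(* Merges the sequences [B n] into one by decoding pairs of indices; [A0] fills the codes of no
   pair. *)
pose C m := if unpickle m is Some nk then B nk.1 nk.2 else A0.
have CA m : AA (C m).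
  by rewrite /C; case: unpickle => // nk; case: (BP nk.1) => h _; exact: h.
exists C; split => // A hA.
have BC n : \bigcup_k B n k `<=` \bigcup_m C m.
  move=> x [k _ Bx]; exists (pickle (n, k)) => //.
  by rewrite /C pickleK.
have supC : sup S <= fine (P (\bigcup_m C m)).
  apply/ler_addgt0Pr => e ep.
  pose n := Num.bound e^-1.
  have ne : n.+1%:R^-1 <= e.
    rewrite invf_ple ?posrE//; apply: le_trans (ltW (archi_boundP _)) _.
      by rewrite invr_ge0 ltW.
    by rewrite ler_nat.
  have [hB] := BP n.
  have : fine (P (\bigcup_k B n k)) <= fine (P (\bigcup_m C m)).
    apply: fine_le; [exact/fP/mU|exact/fP/mU|].
    by apply: le_measure; rewrite ?inE; [exact: mU|exact: mU|exact: BC].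
  by move: (n.+1%:R^-1) ne => i; lra.
pose D m := if m is m'.+1 then C m' else A.
have DA m : AA (D m) by case: m.
have UD : \bigcup_m D m = A `|` \bigcup_m C m.
  apply/seteqP; split => x.
    by move=> [[|m] _ /= h]; [left|right; exists m].
  by case=> [h|[m _ h]]; [exists 0%N|exists m.+1].
have le1 : fine (P (A `|` \bigcup_m C m)) <= fine (P (\bigcup_m C m)).
  apply: le_trans supC; rewrite -UD; apply: ub_le_sup; first by case: hS.
  by exists D.
have mA := mAA _ hA; have mC := mU _ CA.
have : (P (A `|` \bigcup_m C m) <= P (\bigcup_m C m))%E.
  rewrite -(fineK (fP _ mC)) -(fineK (fP _ (measurableU _ _ mA mC))).
  by rewrite lee_fin.
rewrite (_ : A `|` _ = \bigcup_m C m `|` (A `\` \bigcup_m C m)); last first.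
  apply/seteqP; split => x; last by case=> [?|[]]; [right|left].
  by case: (pselect ((\bigcup_m C m) x)) => [?|nC [?|//]]; [left|right].
rewrite measureU//; [|exact: measurableD|by rewrite setDE setIC setIAC -setIA setICr setI0].
rewrite addeC -leeBrDr ?fP// subee ?fP// => h; apply/eqP; rewrite eq_le h/=.
exact: measure_ge0.
Qed.

(** [essential_union] is applied to the level sets [Y > q] for each rational [q]; the countably many
    members found dominate every other member a.e. Existence also ensures that [esssup] does not
    take its default value. *)
Lemma esssup_attained (S : set (T -> \bar R)) : S !=set0 ->
  (forall Y, S Y -> measurable_fun setT Y) ->
  exists Y_ : nat -> T -> \bar R, (forall k, S (Y_ k)) /\
    is_esssup P S (fun x => ereal_sup (range (Y_ ^~ x))).
Proof.
move=> [Y0 SY0] mS.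
have exq (q : rat) : exists Y_ : nat -> T -> \bar R, (forall k, S (Y_ k)) /\
    forall Y, S Y -> {ae P, forall x, ((ratr q)%:E < Y x)%E ->
      exists k, ((ratr q)%:E < Y_ k x)%E}.
  pose lev (Y : T -> \bar R) := [set x | ((ratr q)%:E < Y x)%E].
  have mlev Y : S Y -> measurable (lev Y).
    move=> /mS mY; rewrite -[lev Y]setTI; apply: emeasurable_fun_o_infty => //.
  have [||A_ [hA nA]] := @essential_union [set lev Y | Y in S].
  - by exists (lev Y0); exists Y0.
  - by move=> _ [Y SY <-]; exact: mlev.
  have /choice[Y_ YP] k : exists Y, S Y /\ lev Y = A_ k by have [Y SY h] := hA k; exists Y.
  exists Y_; split; first by move=> k; case: (YP k).
  move=> Y SY; exists (lev Y `\` \bigcup_k A_ k); split.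
  - apply: measurableD; first exact: mlev.
    by apply: bigcupT_measurable => k; case: (YP k) => SYk <-; exact: mlev.
  - by apply: nA; exists Y.
  - move=> x /= /not_implyP[qY nk]; split => // -[k _].
    by case: (YP k) => _ <- h; apply: nk; exists k.
have /choice[Yq YqP] := exq.
pose Y_ m := if unpickle m is Some qk then Yq qk.1 qk.2 else Y0.
have SY_ m : S (Y_ m).
  by rewrite /Y_; case: unpickle => // -[q k]; case: (YqP q) => h _; exact: h.
have le_sup x m : (Y_ m x <= ereal_sup (range (Y_ ^~ x)))%E.
  by apply: ereal_sup_ubound; exists m.
exists Y_; split => //; split.
- have -> : (fun x => ereal_sup (range (Y_ ^~ x))) = (fun x => esups (Y_ ^~ x) 0%N).
    by apply/funext => x; rewrite /esups /sdrop; congr ereal_sup; apply/seteqP;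
      split => _ [m _ <-]; exists m.
  by apply: measurable_fun_esups => m; exact: mS.
- move=> Y SY.
  have : {ae P, forall x, forall q : rat, ((ratr q)%:E < Y x)%E ->
      exists k, ((ratr q)%:E < Yq q k x)%E}.
    by apply: ae_forall_countable => q; case: (YqP q) => _; exact.
  apply: filterS => x hx.
  have {}hx (q : rat) : ((ratr q)%:E < Y x)%E -> ((ratr q)%:E < ereal_sup (range (Y_ ^~ x)))%E.
    move=> /hx[k qk]; apply: lt_le_trans qk _.
    by have := le_sup x (pickle (q, k)); rewrite {1}/Y_ pickleK.
  rewrite leNgt; apply/negP; move: hx; set s := ereal_sup _.
  have rat_lt (a : R) : exists q : rat, ratr q < a :> R.
    have [q] := @rat_in_itvoo R (a - 1) a ltac:(lra).
    by rewrite in_itv/= => /andP[_ ?]; exists q.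
  have rat_gt (a : R) : exists q : rat, a < ratr q :> R.
    have [q] := @rat_in_itvoo R a (a + 1) ltac:(lra).
    by rewrite in_itv/= => /andP[? _]; exists q.
  case: s => [s| |]; case: (Y x) => [y| |]//=; rewrite ?lte_fin => hx // sy.
  + have [q] := rat_in_itvoo sy; rewrite in_itv/= => /andP[sq qy].
    by have := hx q; rewrite !lte_fin => /(_ qy); rewrite ltNge ltW.
  + have [q sq] := rat_gt s.
    by have := hx q (ltry _); rewrite lte_fin ltNge ltW.
  + have [q qy] := rat_lt y.
    by have := hx q; rewrite lte_fin => /(_ qy).
  + by have := hx 0%Q (ltry _).
- move=> Z' mZ' hZ'.
  have : {ae P, forall x, forall m, (Y_ m x <= Z' x)%E}.
    by apply: ae_foralln => m; exact: hZ'.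
  by apply: filterS => x h; apply: ge_ereal_sup => _ [m _ <-].
Qed.

Lemma esssupP (S : set (T -> \bar R)) : S !=set0 ->
  (forall Y, S Y -> measurable_fun setT Y) -> is_esssup P S (esssup P S).
Proof.
move=> S0 mS; have [Y_ [_ h]] := esssup_attained S0 mS.
by rewrite /esssup; case: pselect => [h'|[]]; [case: cid|eexists; exact: h].
Qed.

Lemma is_esssup_unique (S : set (T -> \bar R)) Z1 Z2 :
  is_esssup P S Z1 -> is_esssup P S Z2 -> {ae P, forall x, Z1 x = Z2 x}.
Proof.
move=> [m1 u1 l1] [m2 u2 l2].
have h1 := l1 _ m2 u2; have h2 := l2 _ m1 u1.
by apply: filterS2 h1 h2 => x ? ?; apply/eqP; rewrite eq_le; apply/andP.
Qed.

Lemma esssup_attained_seq (S : set (T -> \bar R)) : S !=set0 ->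
  (forall Y, S Y -> measurable_fun setT Y) ->
  exists2 Y_ : nat -> T -> \bar R, (forall k, S (Y_ k)) &
    {ae P, forall x, esssup P S x = ereal_sup (range (Y_ ^~ x))}.
Proof.
move=> S0 mS; have [Y_ [SY h]] := esssup_attained S0 mS.
exists Y_ => //; apply: is_esssup_unique h; exact: esssupP.
Qed.

End essential_supremum.

(** * Adapted processes and the pairing *)

Section processes.
Context {d : measure_display} {T : measurableType d} {R : realType}.
Variables (P : probability T R) (F : nat -> set (set T)) (t TT : nat).
Hypotheses (hF : filtration F) (tT : (t <= TT)%N).
Implicit Types (X Y a : @process d T R).

Local Notation L1 f := (P.-integrable setT (EFin \o f)).

Lemma filtration_sigma s : sigma_algebra setT (F s).
Proof. by case: hF. Qed.

Lemma filtration_measurable s : F s `<=` measurable.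
Proof. by case: hF. Qed.

Lemma filtration_mono s u : (s <= u)%N -> F s `<=` F u.
Proof.
have [_ _ h _] := hF; elim: u => [|u ih]; first by rewrite leqn0 => /eqP ->.
by rewrite leq_eqVlt => /predU1P[->//|]; rewrite ltnS => /ih su A /su /h.
Qed.

Lemma Gmeas_mono s u (f : T -> R) : (s <= u)%N -> Gmeas (F s) f -> Gmeas (F u) f.
Proof. by move=> su Gf B mB; apply: filtration_mono su _ _; exact: Gf. Qed.

Lemma Gmeas_filtration s (f : T -> R) : Gmeas (F s) f -> measurable_fun setT f.
Proof. exact: (Gmeas_measurable (@filtration_measurable s)). Qed.

(** Only the coordinates from [t] to [TT] have to be checked for adaptedness: the earlier ones are 0
    and the later ones repeat the coordinate [TT]. *)
Lemma Rinf_tTP X : Rinf_tT P F t TT X <->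
  [/\ X = pi_tT t TT X, forall s, (t <= s <= TT)%N -> Gmeas (F s) (X s) &
      exists m : R, {ae P, forall x, forall s, `|X s x| <= m}].
Proof.
split=> [[Y [[adY [m hm]] ->]]|[piX GX [m hm]]].
  split.
  - apply/funext => s; apply/funext => x; rewrite /pi_tT leq_min tT andbT.
    by case: ifPn => // _; rewrite -minnA minnn.
  - move=> s /andP[ts sT]; rewrite /pi_tT ts (minn_idPl sT); exact: adY.
  - exists m; apply: filterS hm => x hx s; rewrite /pi_tT; case: ifPn => // _.
    by rewrite normr0 (le_trans _ (hx 0%N)).
exists X; split => //; split; last by exists m.
move=> s; rewrite piX /pi_tT.
case: (leqP t s) => [ts|_]; last exact: (Gmeas_cst (filtration_sigma s)).
apply: (@Gmeas_mono (minn s TT)); first exact: geq_minl.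
by apply: GX; rewrite leq_min ts tT geq_minr.
Qed.

Lemma Rinf_tT_map2 (f : R -> R -> R) X Y (C : R -> R -> R) : f 0 0 = 0 ->
  (forall s, (t <= s <= TT)%N -> Gmeas (F s) (X s) -> Gmeas (F s) (Y s) ->
     Gmeas (F s) (fun x => f (X s x) (Y s x))) ->
  (forall m n u v, `|u| <= m -> `|v| <= n -> `|f u v| <= C m n) ->
  Rinf_tT P F t TT X -> Rinf_tT P F t TT Y ->
  Rinf_tT P F t TT (fun s x => f (X s x) (Y s x)).
Proof.
move=> f00 fm fC /Rinf_tTP[piX GX [m hm]] /Rinf_tTP[piY GY [n hn]]; apply/Rinf_tTP; split.
- apply/funext => s; apply/funext => x; rewrite {1}piX {1}piY /pi_tT.
  by case: ifP.
- by move=> s ts; apply: fm => //; [exact: GX|exact: GY].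
- by exists (C m n); apply: filterS2 hm hn => x hm hn s; exact: fC.
Qed.

Lemma Rinf_tT_add X Y : Rinf_tT P F t TT X -> Rinf_tT P F t TT Y ->
  Rinf_tT P F t TT (fun s x => X s x + Y s x).
Proof.
apply: (@Rinf_tT_map2 +%R X Y +%R); first exact: addr0.
- by move=> s _; exact: (GmeasD (filtration_sigma s)).
- by move=> m n u v um vn; rewrite (le_trans (ler_normD _ _))// lerD.
Qed.

Lemma Rinf_tT_scale (lam : T -> R) X : Gmeas (F t) lam ->
  (exists c : R, {ae P, forall x, `|lam x| <= c}) -> Rinf_tT P F t TT X ->
  Rinf_tT P F t TT (fun s x => lam x * X s x).
Proof.
move=> Glam [c hc] /Rinf_tTP[piX GX [m hm]]; apply/Rinf_tTP; split.
- apply/funext => s; apply/funext => x; rewrite {1}piX /pi_tT.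
  by case: ifP => // _; rewrite mulr0.
- move=> s /andP[ts sT]; apply: GmeasM; first exact: filtration_sigma.
  + exact: Gmeas_mono ts Glam.
  + by apply: GX; rewrite ts.
- exists (c * m); apply: filterS2 hc hm => x hc hm s.
  by rewrite normrM ler_pM.
Qed.

Lemma Rinf_tT_cst c X : Rinf_tT P F t TT X -> Rinf_tT P F t TT (fun s x => c * X s x).
Proof.
apply: (@Rinf_tT_scale (fun=> c)); first exact: (Gmeas_cst (filtration_sigma t)).
by exists `|c|; exact: aeW.
Qed.

Lemma Rinf_tT_opp X : Rinf_tT P F t TT X -> Rinf_tT P F t TT (fun s x => - X s x).
Proof.
move=> /(Rinf_tT_cst (-1)); congr (Rinf_tT P F t TT _).
by apply/funext => s; apply/funext => x; rewrite mulN1r.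
Qed.

Lemma Rinf_tT_indic (A : set T) X : F t A -> Rinf_tT P F t TT X ->
  Rinf_tT P F t TT (fun s x => \1_A x * X s x).
Proof.
move=> FA; apply: Rinf_tT_scale; first exact: (Gmeas_indic (filtration_sigma t) FA).
exists 1; apply: aeW => x.
by case: (bounded_mfun_indic (R := R) (filtration_measurable FA)) => _; exact.
Qed.

Lemma Rinf_tT_pay (m : T -> R) : Gmeas (F t) m ->
  (exists c : R, {ae P, forall x, `|m x| <= c}) ->
  Rinf_tT P F t TT (fun s x => if (t <= s)%N then m x else 0).
Proof.
move=> Gm [c hc]; apply/Rinf_tTP; split.
- apply/funext => s; apply/funext => x; rewrite /pi_tT leq_min tT andbT.
  by case: ifP.
- by move=> s /andP[ts sT]; rewrite ts; exact: Gmeas_mono ts Gm.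
- exists c; apply: filterS hc => x h s; case: ifP => // _.
  by rewrite normr0 (le_trans _ h).
Qed.

Lemma Rinf_tT_sum n (X : 'I_n -> @process d T R) : (forall i, Rinf_tT P F t TT (X i)) ->
  Rinf_tT P F t TT (sum_proc X).
Proof.
move=> hX; rewrite /sum_proc; elim: n X hX => [X _|n ih X hX].
  rewrite (_ : (fun _ => _) = fun s x => if (t <= s)%N then 0 else 0); last first.
    by apply/funext => s; apply/funext => x; rewrite big_ord0; case: ifP.
  apply: Rinf_tT_pay; first exact: (Gmeas_cst (filtration_sigma t)).
  by exists 0; apply: aeW => x; rewrite normr0.
under eq_fun do under eq_fun do rewrite big_ord_recl.
apply: Rinf_tT_add; first exact: hX.
by apply: (ih (fun i => X (lift ord0 i))) => i; exact: hX.
Qed.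

Lemma Rinf_tT_avg n (X : 'I_n -> @process d T R) : (forall i, Rinf_tT P F t TT (X i)) ->
  Rinf_tT P F t TT (avg_proc X).
Proof. by move=> hX; exact: (Rinf_tT_cst n%:R^-1 (Rinf_tT_sum hX)). Qed.

Lemma L1_ae_le (f g : T -> R) : measurable_fun setT f -> L1 g ->
  {ae P, forall x, `|f x| <= `|g x|} -> L1 f.
Proof.
move=> mf Lg fg; apply/integrableP; split; first exact/measurable_EFinP.
move/integrableP : (Lg) => [_]; apply: le_lt_trans.
apply: ae_ge0_le_integral => //.
- by apply/measurable_EFinP; exact: measurableT_comp.
- by apply/measurable_EFinP; apply: measurableT_comp => //; exact: L1_measurable Lg.
- by apply: filterS fg => x h _; rewrite lee_fin.
Qed.

Lemma L1_ae_bounded (f : T -> R) (m : R) : measurable_fun setT f ->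
  {ae P, forall x, `|f x| <= m} -> L1 f.
Proof.
move=> mf fm; apply: (L1_ae_le mf (L1_bounded (bounded_mfun_cst m))).
by apply: filterS fm => x h; rewrite (le_trans h)// ler_norm.
Qed.

(** What integrability of the pairing asks of a position. It admits the constant process 1 that
    normalises [D_tT], which is not in the range of [pi_tT] when [t] is positive. *)
Definition ae_bounded_coords X := forall s, (t <= s <= TT)%N ->
  measurable_fun setT (X s) /\ exists m : R, {ae P, forall x, `|X s x| <= m}.

Lemma Rinf_tT_bounded X : Rinf_tT P F t TT X -> ae_bounded_coords X.
Proof.
move=> /Rinf_tTP[_ GX [m hm]] s ts; split; first exact: Gmeas_filtration (GX _ ts).
by exists m; apply: filterS hm => x; exact.
Qed.

Lemma ae_bounded_coords_cst c : ae_bounded_coords (fun _ _ => c).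
Proof. by move=> s _; split => //; exists `|c|; exact: aeW. Qed.

Section pairing_with_density.
Variable a : @process d T R.
Hypothesis La : forall s, (t <= s <= TT)%N -> L1 (delta a s).

Local Notation S X := (fun x => \sum_(t <= s < TT.+1) X s x * delta a s x).

Lemma L1_coord X s : ae_bounded_coords X -> (t <= s <= TT)%N ->
  L1 (fun x => X s x * delta a s x).
Proof.
move=> bX ts; have [mX [m hm]] := bX _ ts.
apply: (@L1_ae_le _ (fun x => m * delta a s x)).
- by apply: measurable_funM => //; exact: L1_measurable (La ts).
- exact: L1Z (La ts).
- apply: filterS hm => x h; rewrite !normrM ler_wpM2r//.
  by rewrite (le_trans h)// ler_norm.
Qed.

Lemma L1_pairing X : ae_bounded_coords X -> L1 (S X).
Proof.
move=> bX; rewrite (_ : (fun x => _) =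
  fun x => \sum_(t <= s < TT.+1) if (t <= s <= TT)%N then X s x * delta a s x else 0).
  apply: L1_sum => s; case: (boolP (t <= s <= TT)%N) => ts; first exact: L1_coord.
  exact: (@integrable0 _ _ _ P setT).
apply/funext => x; rewrite big_nat_cond [RHS]big_nat_cond; apply: eq_bigr => s.
by rewrite andbT ltnS => ->.
Qed.

Let hG := filtration_sigma t.
Let GT := @filtration_measurable t.

Lemma pairing_ae_congr X Y : ae_bounded_coords X -> ae_bounded_coords Y ->
  {ae P, forall x, forall s, (t <= s <= TT)%N -> X s x = Y s x} ->
  {ae P, forall x, pairing P F t TT X a x = pairing P F t TT Y a x}.
Proof.
move=> bX bY XY; apply: condexp_ae_congr => //; [exact: L1_pairing|exact: L1_pairing|].
apply: filterS XY => x XY; rewrite big_nat_cond [RHS]big_nat_cond; apply: eq_bigr => s.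
by rewrite andbT ltnS => ts; rewrite XY.
Qed.

Lemma pairing_add X Y : ae_bounded_coords X -> ae_bounded_coords Y ->
  {ae P, forall x, pairing P F t TT (fun s y => X s y + Y s y) a x =
     pairing P F t TT X a x + pairing P F t TT Y a x}.
Proof.
move=> bX bY; have := condexpD hG GT (L1_pairing bX) (L1_pairing bY).
apply: filterS => x <-; congr (condexp P (F t) _ x); apply/funext => y.
by rewrite -big_split/=; apply: eq_bigr => s _; rewrite mulrDl.
Qed.

Lemma pairing_scale c X : ae_bounded_coords X ->
  {ae P, forall x, pairing P F t TT (fun s y => c * X s y) a x =
     c * pairing P F t TT X a x}.
Proof.
move=> bX; have := condexpZ hG GT c (L1_pairing bX).
apply: filterS => x <-; congr (condexp P (F t) _ x); apply/funext => y.
by rewrite big_distrr/=; apply: eq_bigr => s _; rewrite mulrA.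
Qed.

Lemma pairing_indic (A : set T) X : F t A -> ae_bounded_coords X ->
  {ae P, forall x, pairing P F t TT (fun s y => \1_A y * X s y) a x =
     \1_A x * pairing P F t TT X a x}.
Proof.
move=> FA bX; have := condexp_indic hG GT FA (L1_pairing bX).
apply: filterS => x <-; congr (condexp P (F t) _ x); apply/funext => y.
by rewrite big_distrr/=; apply: eq_bigr => s _; rewrite mulrA.
Qed.

Lemma pairing_sum n (X : 'I_n -> @process d T R) : (forall i, ae_bounded_coords (X i)) ->
  {ae P, forall x, pairing P F t TT (sum_proc X) a x =
     \sum_(i < n) pairing P F t TT (X i) a x}.
Proof.
move=> bX; have := condexp_sum hG GT (index_enum 'I_n) (fun i => L1_pairing (bX i)).
apply: filterS => x <-; congr (condexp P (F t) _ x); apply/funext => y.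
rewrite exchange_big/=; apply: eq_bigr => s _.
by rewrite /sum_proc mulr_suml.
Qed.

Lemma Gmeas_pairing X : Gmeas (F t) (pairing P F t TT X a).
Proof. exact: Gmeas_condexp. Qed.

Lemma L1_pairing_condexp X : L1 (pairing P F t TT X a).
Proof. exact: L1_condexp. Qed.

Lemma Rintegral_pairing (A : set T) X : F t A -> ae_bounded_coords X ->
  \int[P]_x (\1_A x * pairing P F t TT X a x) = \int[P]_x (\1_A x * S X x).
Proof. by move=> FA bX; exact: Rintegral_condexp (L1_pairing bX) FA. Qed.

End pairing_with_density.

(** The projected process is 0 before [t], so its increment at [t] is the whole value [a t], which
    collects all earlier increments. *)
Lemma delta_pi_tT a s : (t <= s <= TT)%N ->
  delta (pi_tT t TT a) s = if s == t then a t else delta a s.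
Proof.
move=> /andP[ts sT]; apply/funext => x; rewrite /delta /pi_tT ts (minn_idPl sT).
case: eqP => [->|/eqP st].
  by case: (t) => [|t']; rewrite ?ltnn ?subr0// leqnn subr0.
case: s ts sT st => [|s] ts sT st; first by move: ts st; rewrite leqn0 eq_sym => ->.
have ts' : (t <= s)%N by rewrite -ltnS ltn_neqAle eq_sym st ts.
by rewrite ts' (minn_idPl (ltnW sT)).
Qed.

Lemma A1_L1_delta a s : A1 P F a -> L1 (delta a s).
Proof.
move=> [ada ia].
have Gd u : Gmeas (F u) (delta a u).
  apply: GmeasB; [exact: filtration_sigma|exact: ada|].
  case: u => [|u]; first exact: (Gmeas_cst (filtration_sigma _)).
  by apply: (@Gmeas_mono u) => //; exact: ada.
have md u : measurable_fun setT (delta a u) by exact: Gmeas_filtration (Gd u).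
apply/integrableP; split; first exact/measurable_EFinP.
apply: le_lt_trans ia; apply: ge0_le_integral => //.
- by apply/measurable_EFinP; exact: measurableT_comp.
- apply: (@ge0_emeasurable_sum _ _ _ _ (fun j x => (`|delta a j x|)%:E) xpredT).
    by move=> k x _ _; rewrite lee_fin.
  by move=> k _; apply/measurable_EFinP; exact: measurableT_comp.
- move=> x _; apply: (@le_trans _ _ (\sum_(0 <= k < s.+1) (`|delta a k x|)%:E)%E).
    rewrite big_nat_recr//= leeDr//; apply: sume_ge0 => i _; rewrite lee_fin//.
  by apply: nneseries_lim_ge => k _ _; rewrite lee_fin.
Qed.

Lemma A1_L1 a s : A1 P F a -> L1 (a s).
Proof.
move=> Aa; elim: s => [|s ih].
  have := A1_L1_delta 0%N Aa; congr (is_true (P.-integrable _ (EFin \o _))).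
  by apply/funext => x; rewrite /delta subr0.
have := L1D (A1_L1_delta s.+1 Aa) ih; congr (is_true (P.-integrable _ (EFin \o _))).
by apply/funext => x; rewrite /delta subrK.
Qed.

Lemma D_L1_delta a s : D_tT P F t TT a -> (t <= s <= TT)%N -> L1 (delta a s).
Proof.
move=> [[a' [[Aa' _] ->]] _] ts; rewrite delta_pi_tT//; case: ifP => _.
  exact: A1_L1.
exact: A1_L1_delta.
Qed.

End processes.

(** * Utilities as functionals on the optional space *)

(* A real function on nat * T measurable for this sigma-algebra is exactly an
   adapted process. *)
Definition optional_sets {d} {T : measurableType d} (F : nat -> set (set T))
  : set (set (nat * T)) := [set A | forall s, F s [set x | A (s, x)]].

Section optional_space.
Context {d : measure_display} {T : measurableType d} {R : realType}.
Variables (P : probability T R) (F : nat -> set (set T)) (t TT : nat).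
Hypotheses (hF : filtration F).

Local Notation OT := (g_sigma_algebraType (optional_sets F)).

Lemma optional_sigma_algebra : sigma_algebra setT (optional_sets F).
Proof.
split.
- by move=> s; case: (filtration_sigma hF s) => h _ _; exact: h.
- move=> A hA s; rewrite setTD.
  exact: (G_setC (filtration_sigma hF s)).
- move=> A_ hA s; case: (filtration_sigma hF s) => _ _.
  by move=> /(_ (fun n => [set x | A_ n (s, x)]) (fun n => hA n s)).
Qed.

Lemma optional_measurableE : measurable = optional_sets F :> set (set OT).
Proof. exact: (measurable_g_measurableTypeE optional_sigma_algebra). Qed.

Lemma optional_measurable_funP (U : OT -> R) :
  measurable_fun setT U <-> forall s, Gmeas (F s) (fun x => U (s, x)).
Proof.
split=> [mU s B mB|GU _ B mB].
  by have := mU measurableT B mB; rewrite setTI optional_measurableE => /(_ s).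
by rewrite setTI optional_measurableE => s; exact: GU.
Qed.

Lemma measurable_slice s : measurable_fun setT ((fun x => (s, x)) : T -> OT).
Proof.
move=> _ B; rewrite optional_measurableE => OB; rewrite setTI.
exact: (filtration_measurable hF (OB s)).
Qed.

(** The measure is the sum over [s] from [t] to [TT] of the images of [P] under the slice maps. The
    two clauses carry null sets and integrals back to [P]. *)
Lemma optional_measure_exists : exists mu : {finite_measure set OT -> \bar R},
  (forall Q : OT -> Prop, {ae mu, forall o, Q o} ->
     {ae P, forall x, forall s, (t <= s <= TT)%N -> Q (s, x)}) /\
  (forall f : OT -> R, mu.-integrable setT (EFin \o f) ->
     (forall s, (t <= s <= TT)%N ->
       P.-integrable setT (EFin \o (fun x => f (s, x)))) /\
     \int[mu]_o f o = \sum_(t <= s < TT.+1) \int[P]_x f (s, x)).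
Proof.
pose emb s : {mfun T >-> OT} := HB.pack ((fun x => (s, x)) : T -> OT)
  (isMeasurableFun.Build _ _ _ _ _ (measurable_slice s)).
pose m_ i : {measure set OT -> \bar R} := distribution P (emb (t + i)%N).
pose N := (TT.+1 - t)%N.
have fin : fin_num_fun (msum m_ N).
  move=> A mA; rewrite /msum sum_fin_num; apply/allP => _ /mapP[i _ ->] /=.
  by apply: (fin_num_measure (distribution P (emb (t + i)%N))).
pose mu : {finite_measure set OT -> \bar R} :=
  HB.pack (msum m_ N) (Measure_isFinite.Build _ _ _ (msum m_ N) fin).
have sumE (f : nat -> \bar R) : (\sum_(i < N) f (t + i)%N = \sum_(t <= s < TT.+1) f s)%E.
  rewrite -[in RHS](add0n t) big_addn big_mkord; apply: eq_bigr => i _.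
  by rewrite addnC.
have ge0E (f : OT -> R) : measurable_fun setT f -> (forall o, 0 <= f o) ->
    (\int[mu]_o (f o)%:E = \sum_(t <= s < TT.+1) \int[P]_x (f (s, x))%:E)%E.
  move=> mf f0; rewrite -sumE /mu/= ge0_integral_measure_sum//; last 2 first.
  - by move=> o _; rewrite lee_fin.
  - exact/measurable_EFinP.
  apply: eq_bigr => i _.
  by rewrite /m_ ge0_integral_distribution//; exact/measurable_EFinP.
have coord s (f : nat -> \bar R) : (t <= s <= TT)%N -> (forall u, 0 <= f u)%E ->
    (f s <= \sum_(t <= u < TT.+1) f u)%E.
  move=> ts f0; rewrite (bigD1_seq s) ?iota_uniq//=; last by rewrite mem_index_iota ltnS.
  by rewrite leeDl// sume_ge0.
exists mu; split.
- move=> Q [A [mA muA QA]].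
  apply: ae_foralln => s.
  have [ts|ts] := boolP (t <= s <= TT)%N; last by apply: aeW.
  exists [set x | A (s, x)]; split.
  + by move: mA; rewrite optional_measurableE => /(_ s) /(filtration_measurable hF).
  + apply/eqP; rewrite eq_le measure_ge0 andbT -muA.
    have := coord s (fun u => P [set x | A (u, x)]) ts (fun u => measure_ge0 _ _).
    by rewrite -sumE.
  + by move=> x /= /not_implyP[_ nQ]; apply: QA.
- move=> f Lf.
  have mf := L1_measurable Lf.
  have ms s : measurable_fun setT (fun x => f (s, x)).
    by move/optional_measurable_funP : (mf) => /(_ s); exact: Gmeas_filtration.
  have LP (g : OT -> R) : mu.-integrable setT (EFin \o g) -> forall s, (t <= s <= TT)%N ->
      P.-integrable setT (EFin \o (fun x => g (s, x))).
    move=> Lg s ts; have mg := L1_measurable Lg.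
    apply/integrableP; split.
      apply/measurable_EFinP.
      by move/optional_measurable_funP : (mg) => /(_ s); exact: Gmeas_filtration.
    move/integrableP : (Lg) => [_]; apply: le_lt_trans.
    rewrite (ge0E (fun o => `|g o|))//; last exact: measurableT_comp.
    apply: (coord s (fun u => (\int[P]_x (`|g (u, x)|)%:E)%E)) => // u.
    by apply: integral_ge0 => x _; rewrite lee_fin.
  split; first exact: LP.
  have R0 (g : OT -> R) : mu.-integrable setT (EFin \o g) -> (forall o, 0 <= g o) ->
      \int[mu]_o g o = \sum_(t <= s < TT.+1) \int[P]_x g (s, x).
    move=> Lg g0; apply: EFin_inj; rewrite EFin_Rintegral// ge0E//; last exact: L1_measurable Lg.
    rewrite -sumEFin big_nat_cond [RHS]big_nat_cond; apply: eq_bigr => s.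
    by rewrite andbT ltnS => ts; rewrite EFin_Rintegral//; exact: LP.
  have Lh : mu.-integrable setT (EFin \o (fun o => `|f o| - f o)) by apply: L1B => //;
    exact: L1_abs.
  have h0 o : 0 <= `|f o| - f o by rewrite subr_ge0 ler_norm.
  (* The nonnegative case extends by writing [f] as [|f|] minus the nonnegative [|f| - f]. *)
  have -> : \int[mu]_o f o = (\int[mu]_o `|f o|) - \int[mu]_o (`|f o| - f o).
    by rewrite RintegralB ?L1_abs// opprB addrC subrK.
  rewrite !R0 ?L1_abs// -sumrB big_nat_cond [RHS]big_nat_cond; apply: eq_bigr => s.
  rewrite andbT ltnS => ts; have Ls := LP _ Lf _ ts.
  by rewrite RintegralB ?L1_abs// opprB addrC subrK.
Qed.

End optional_space.

(** * Pasting, and an integrable supergradient of the expected utility *)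

Section monetary_utility.
Context {d : measure_display} {T : measurableType d} {R : realType}.
Variables (P : probability T R) (F : nat -> set (set T)) (t TT : nat).
Variable phi : @process d T R -> T -> R.
Hypotheses (hF : filtration F) (tT : (t <= TT)%N).
Hypothesis hM : monetary_utility P F t TT phi.
Implicit Types (X Y : @process d T R).

Local Notation L1 f := (P.-integrable setT (EFin \o f)).
Local Notation Rf := (Rinf_tT P F t TT).
Local Notation OT := (g_sigma_algebraType (optional_sets F)).

Lemma expectation_cst (c : R) : \int[P]_x c = c.
Proof.
rewrite Rintegral_cst// [X in fine X](_ : _ = 1%E) ?mulr1//.
exact: probability_setT.
Qed.

Lemma phi_le X Y : Rf X -> Rf Y -> {ae P, forall x, forall s, X s x <= Y s x} ->
  {ae P, forall x, phi X x <= phi Y x}.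
Proof. by case: hM => _ _ h _; exact: h. Qed.

Lemma phi_ae_eq X Y : Rf X -> Rf Y -> {ae P, forall x, forall s, X s x = Y s x} ->
  {ae P, forall x, phi X x = phi Y x}.
Proof.
move=> RX RY XY.
have h1 : {ae P, forall x, phi X x <= phi Y x}.
  by apply: phi_le => //; apply: filterS XY => x h s; rewrite h.
have h2 : {ae P, forall x, phi Y x <= phi X x}.
  by apply: phi_le => //; apply: filterS XY => x h s; rewrite h.
by apply: filterS2 h1 h2 => x ? ?; apply/eqP; rewrite eq_le; apply/andP.
Qed.

Lemma Gmeas_phi X : Rf X -> Gmeas (F t) (phi X).
Proof. by case: hM => h _ _ _ /h[]. Qed.

Lemma phi_bounded X : Rf X -> exists m : R, {ae P, forall x, `|phi X x| <= m}.
Proof. by case: hM => h _ _ _ /h[]. Qed.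

Lemma L1_phi X : Rf X -> L1 (phi X).
Proof.
move=> RX; have [m hm] := phi_bounded RX.
by apply: L1_ae_bounded hm; exact: (Gmeas_filtration hF (Gmeas_phi RX)).
Qed.

Lemma phi_cash X (m : T -> R) : Rf X -> Gmeas (F t) m ->
  (exists c : R, {ae P, forall x, `|m x| <= c}) ->
  {ae P, forall x, phi (fun s y => X s y + (if (t <= s)%N then m y else 0)) x
     = phi X x + m x}.
Proof. by case: hM => _ _ _ h; exact: h. Qed.

Lemma phi_cash_cst X c : Rf X ->
  {ae P, forall x, phi (fun s y => X s y + (if (t <= s)%N then c else 0)) x
     = phi X x + c}.
Proof.
move=> RX; apply: (@phi_cash X (fun=> c)) => //.
  exact: (Gmeas_cst (filtration_sigma hF t)).
by exists `|c|; exact: aeW.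
Qed.

Lemma Rinf_tT_pay_cst c : Rf (fun s x => if (t <= s)%N then c else 0).
Proof.
apply: (@Rinf_tT_pay _ _ _ _ _ _ _ hF tT (fun=> c)).
  exact: (Gmeas_cst (filtration_sigma hF t)).
by exists `|c|; exact: aeW.
Qed.

Lemma Rinf_tT_paste (A : set T) X Y : F t A -> Rf X -> Rf Y ->
  Rf (fun s x => \1_A x * X s x + \1_(~` A) x * Y s x).
Proof.
move=> FA RX RY; apply: (Rinf_tT_add hF tT).
  exact: (Rinf_tT_indic hF tT FA).
exact: (Rinf_tT_indic hF tT (G_setC (filtration_sigma hF t) FA)).
Qed.

Lemma indic_paste (A : set T) x (u v : R) :
  \1_A x * (\1_A x * u + \1_(~` A) x * v) = \1_A x * u.
Proof.
rewrite !indicE in_setC; case: (_ \in _) => /=; rewrite ?mul0r//.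
by rewrite !mul1r addr0.
Qed.

(** Multiplying the pasted position by either indicator leaves that piece alone; locality for the
    piece and for the pasted position then identifies [phi] on [A] and on its complement. *)
Lemma phi_paste (A : set T) X Y : F t A -> Rf X -> Rf Y ->
  {ae P, forall x, phi (fun s x => \1_A x * X s x + \1_(~` A) x * Y s x) x
     = \1_A x * phi X x + \1_(~` A) x * phi Y x}.
Proof.
move=> FA RX RY; have FC := G_setC (filtration_sigma hF t) FA.
have RW := Rinf_tT_paste FA RX RY.
have [_ loc _ _] := hM.
have h1 := loc _ _ FA RX; have h2 := loc _ _ FC RY.
have h3 := loc _ _ FA RW; have h4 := loc _ _ FC RW.
have e3 : (fun s y => \1_A y * (\1_A y * X s y + \1_(~` A) y * Y s y)) =
    (fun s y => \1_A y * X s y).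
  by apply/funext => s; apply/funext => y; rewrite indic_paste.
have e4 : (fun s y => \1_(~` A) y * (\1_A y * X s y + \1_(~` A) y * Y s y)) =
    (fun s y => \1_(~` A) y * Y s y).
  apply/funext => s; apply/funext => y; rewrite !indicE in_setC.
  by case: (_ \in _) => /=; rewrite ?mul0r ?mul1r ?add0r ?mul0r.
rewrite e3 in h3; rewrite e4 in h4.
have h12 : {ae P, forall x, \1_A x * phi (fun s x => \1_A x * X s x + \1_(~` A) x * Y s x)
  x = \1_A x * phi X x}.
  by apply: filterS2 h1 h3 => x <- <-.
have h34 : {ae P, forall x, \1_(~` A) x * phi (fun s x => \1_A x * X s x + \1_(~` A) x * Y
  s x) x = \1_(~` A) x * phi Y x}.
  by apply: filterS2 h2 h4 => x <- <-.
apply: filterS2 h12 h34 => x; rewrite !indicE in_setC.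
by case: (_ \in _) => /=; rewrite ?mul1r ?mul0r ?addr0 ?add0r.
Qed.

Hypothesis hC : concave_mu P F t TT phi.
Hypothesis hD : cont_bdd_decr P F t TT phi.

Let proc (U : OT -> R) : @process d T R := pi_tT t TT (fun s x => U (s, x)).

Lemma Rinf_tT_proc r (U : OT -> R) : bounded_mfun r U -> Rf (proc U).
Proof.
move=> [mU bU]; exists (fun s x => U (s, x)); split => //; split.
  exact/(optional_measurable_funP hF).
by exists r; apply: aeW => x s.
Qed.

Section fixed_position.
Variable X : @process d T R.
Hypothesis RX : Rf X.

Let shift (U : OT -> R) : @process d T R := fun s x => X s x + proc U s x.

Let Rf_shift r (U : OT -> R) : bounded_mfun r U -> Rf (shift U).
Proof. by move=> bU; apply: (Rinf_tT_add hF tT RX); exact: Rinf_tT_proc bU. Qed.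

Let psi (U : OT -> R) := \int[P]_x phi (shift U) x - \int[P]_x phi X x.

Let proc_bound r (U : OT -> R) s x : (forall o, `|U o| <= r) ->
  - (if (t <= s)%N then r else 0) <= proc U s x <= (if (t <= s)%N then r else 0).
Proof.
move=> bU; rewrite /proc /pi_tT; case: ifP => _; first by rewrite -ler_norml.
by rewrite oppr0 lexx.
Qed.

Let phi_shift_le r (U : OT -> R) : bounded_mfun r U ->
  {ae P, forall x, phi (shift U) x <= phi X x + r}.
Proof.
move=> bU; have := phi_cash_cst r RX.
have : {ae P, forall x, phi (shift U) x <= phi (fun s y => X s y + (if (t
  <= s)%N then r else 0)) x}.
  apply: phi_le.
  - exact: Rf_shift bU.
  - exact: (Rinf_tT_add hF tT RX (Rinf_tT_pay_cst r)).
  - apply: aeW => x s; rewrite lerD2l; case: bU => _ bU.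
    by have /andP[] := proc_bound s x bU.
by apply: filterS2 => x h <-.
Qed.

Let phi_shift_ge r (U : OT -> R) : bounded_mfun r U ->
  {ae P, forall x, phi X x - r <= phi (shift U) x}.
Proof.
move=> bU; have := phi_cash_cst (- r) RX.
have : {ae P, forall x, phi (fun s y => X s y + (if (t <= s)%N then - r else 0)) x
  <= phi (shift U) x}.
  apply: phi_le.
  - exact: (Rinf_tT_add hF tT RX (Rinf_tT_pay_cst (- r))).
  - exact: Rf_shift bU.
  - apply: aeW => x s; rewrite lerD2l; case: bU => _ bU.
    by have /andP[+ _] := proc_bound s x bU; case: ifP => _ //; rewrite oppr0.
by apply: filterS2 => x h <-.
Qed.

Let psi_concave : concave_fun psi.
Proof.
move=> r c U V c01 bU bV.
have bW := bounded_mfun_conv c01 bU bV.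
have RU := Rf_shift bU; have RV := Rf_shift bV; have RW := Rf_shift bW.
have := hC RU RV (Gmeas_cst (filtration_sigma hF t) c) (aeW _ (fun=> c01)).
rewrite (_ : (fun s y => _ + _) = shift (fun o => c * U o + (1 - c) * V o)); last first.
  apply/funext => s; apply/funext => x; rewrite /shift /proc /pi_tT; case: ifP => _; ring.
move=> h.
have : \int[P]_x (c * phi (shift U) x + (1 - c) * phi (shift V) x) <=
    \int[P]_x phi (shift (fun o => c * U o + (1 - c) * V o)) x.
  apply: Rintegral_ae_le h; last exact: L1_phi.
  by apply: L1D; apply: L1Z; exact: L1_phi.
rewrite RintegralD// ?L1Z ?L1_phi// !RintegralZl ?L1_phi// /psi; lra.
Qed.

Let psi0 : psi (fun _ => 0) = 0.
Proof.
rewrite /psi (_ : shift (fun=> 0) = X) ?subrr//.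
apply/funext => s; apply/funext => x; rewrite /shift /proc /pi_tT.
by case: ifP => _; rewrite addr0.
Qed.

Let psi_le r (U : OT -> R) : bounded_mfun r U -> psi U <= r.
Proof.
move=> bU; have h := phi_shift_le bU.
have : \int[P]_x phi (shift U) x <= \int[P]_x (phi X x + r).
  apply: Rintegral_ae_le h; first exact: (L1_phi (Rf_shift bU)).
  by apply: L1D; [exact: L1_phi|exact: (L1_bounded (bounded_mfun_cst r))].
rewrite RintegralD//; [|exact: L1_phi|exact: (L1_bounded (bounded_mfun_cst r))].
by rewrite expectation_cst /psi; lra.
Qed.

(* Fatou property from continuity along decreasing sequences: dominate U_ k by
   the decreasing sequence sup_{j >= k} U_ j. *)
Let psi_fatou (mu : {finite_measure set OT -> \bar R}) :
  (forall Q : OT -> Prop, {ae mu, forall o, Q o} ->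
     {ae P, forall x, forall s, (t <= s <= TT)%N -> Q (s, x)}) ->
  fatou_usc mu psi.
Proof.
move=> muP r U_ U c bU_ bU UU hc.
have ubU o : has_ubound (range (U_ ^~ o)).
  by exists r => _ [n _ <-]; case: (bU_ n) => _ /(_ o); rewrite ler_norml => /andP[].
pose V k o := sups (U_ ^~ o) k.
have UV k o : U_ k o <= V k o.
  by apply: ub_le_sup; [exact: has_ubound_sdrop|exists k => /=].
have bV k : bounded_mfun r (V k).
  split.
    by apply: measurable_fun_sups => // n; case: (bU_ n).
  move=> o; rewrite ler_norml; apply/andP; split.
    apply: le_trans (UV k o).
    by case: (bU_ k) => _ /(_ o); rewrite ler_norml => /andP[].
  apply: ge_sup; first by exists (U_ k o); exists k => /=.
  by move=> _ [n _ <-]; case: (bU_ n) => _ /(_ o); rewrite ler_norml => /andP[].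
have decV k o : V k.+1 o <= V k o by apply: (nonincreasing_sups (ubU o)).
have cV : {ae mu, forall o, V k o @[k --> \oo] --> U o}.
  by apply: filterS UU => o; exact: cvg_sups.
have Vc k : c <= psi (V k).
  apply: le_trans (hc k) _; rewrite /psi lerD2r.
  apply: Rintegral_ae_le; rewrite ?(L1_phi (Rf_shift (bU_ k))) ?(L1_phi (Rf_shift (bV k)))//.
  apply: phi_le; [exact: Rf_shift (bU_ k)|exact: Rf_shift (bV k)|].
  by apply: aeW => x s; rewrite lerD2l /proc /pi_tT; case: ifP.
have cphi : {ae P, forall x, phi (shift (V k)) x @[k --> \oo] --> phi (shift U) x}.
  apply: (@hD (fun k => shift (V k)) (shift U)).
  - by move=> k; exact: Rf_shift (bV k).
  - exact: Rf_shift bU.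
  - by move=> k; apply: aeW => x s; rewrite lerD2l /proc /pi_tT; case: ifP.
  - have := muP _ cV; apply: filterS => x h s.
    apply: cvgD; first exact: cvg_cst.
    rewrite /proc /pi_tT; case: ifPn => ts; last exact: cvg_cst.
    by apply: h; rewrite leq_min ts tT geq_minr.
have [mX hX] := phi_bounded RX.
(* Monotonicity and cash invariance keep [phi (shift (V k))] within [r] of [phi X], which supplies
   the constant majorant. *)
have [_ _ cv] : [/\ L1 (phi (shift U)),
    (\int[P]_x `|phi (shift (V k)) x - phi (shift U) x|) @[k --> \oo] --> (0 : R) &
    (\int[P]_x phi (shift (V k)) x) @[k --> \oo] --> \int[P]_x phi (shift U) x].
  apply: (@Rintegral_dominated _ _ _ P _ _ (fun=> (mX + r)%:E)).
  - by move=> k; exact: L1_measurable (L1_phi (Rf_shift (bV k))).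
  - exact: L1_measurable (L1_phi (Rf_shift bU)).
  - exact: cphi.
  - exact: (L1_bounded (bounded_mfun_cst _)).
  - apply: ae_foralln => k.
    have h1 := phi_shift_le (bV k); have h2 := phi_shift_ge (bV k).
    apply: filterS3 hX h1 h2 => x; rewrite lee_fin !ler_norml; lra.
have : c + \int[P]_x phi X x <= \int[P]_x phi (shift U) x.
  rewrite -(cvg_lim _ cv)//; apply: limr_ge; first exact: cvgP cv.
  by apply: nearW => k; have := Vc k; rewrite /psi; lra.
by rewrite /psi; lra.
Qed.

(** The slices of an integrable supergradient on the optional space form an adapted family of
    densities. *)
Lemma dual_density (eps : R) : 0 < eps -> exists Z : nat -> T -> R,
  [/\ forall s, Gmeas (F s) (Z s), forall s, (t <= s <= TT)%N -> L1 (Z s) &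
   forall Y, Rf Y -> \int[P]_x phi (fun s x => X s x + Y s x) x <=
     \int[P]_x phi X x + eps + \sum_(t <= s < TT.+1) \int[P]_x (Y s x * Z s x)].
Proof.
move=> eps0; have [mu [muP muI]] := optional_measure_exists P t TT hF.
have [Z LZ hZ] := fatou_usc_supergradient psi_concave (psi_fatou muP) psi0 psi_le eps0.
exists (fun s x => Z (s, x)); split.
- by apply/(optional_measurable_funP hF); exact: L1_measurable LZ.
- by have [] := muI _ LZ.
move=> Y RY; have /(Rinf_tTP P hF tT)[piY GY [m hm]] := RY.
(* A version of [Y] bounded at every point; clipping at the a.e. bound changes it inside the time
   window only on a null set, and [|m|] is a nonnegative level. *)
pose U : OT -> R := fun o => if (t <= o.1 <= TT)%N then clip `|m| (Y o.1 o.2) else 0.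
have bU : bounded_mfun `|m| U.
  split.
    apply/(optional_measurable_funP hF) => s; rewrite /U /=.
    case: (boolP (t <= s <= TT)%N) => ts; last exact: (Gmeas_cst (filtration_sigma hF s)).
    apply/(GmeasP (filtration_sigma hF s)); apply: measurable_clip.
    by apply/(GmeasP (filtration_sigma hF s)); exact: GY.
  move=> o; rewrite /U; case: ifP => _; last by rewrite normr0.
  by rewrite ler_norml clip_bound.
have UY : {ae P, forall x, forall s, (t <= s <= TT)%N -> U (s, x) = Y s x}.
  apply: filterS hm => x h s ts; rewrite /U /= ts clip_id//.
  by rewrite (le_trans (h s))// ler_norm.
have := hZ _ _ bU; have [LUZ ->] := muI _ (L1M bU LZ).
rewrite /psi.
have -> : \int[P]_x phi (shift U) x = \int[P]_x phi (fun s x => X s x + Y s x) x.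
  have RXY := Rinf_tT_add hF tT RX RY.
  apply: Rintegral_ae_eq; [exact: (L1_phi (Rf_shift bU))|exact: L1_phi|].
  apply: phi_ae_eq => //; first exact: Rf_shift bU.
  apply: filterS UY => x h s; congr (_ + _); rewrite [in RHS]piY /proc /pi_tT.
  by case: ifPn => // ts; apply: h; rewrite leq_min ts tT geq_minr.
rewrite lerBlDl addrA => h; apply: le_trans h _; rewrite lerD2l.
rewrite big_nat_cond [leRHS]big_nat_cond; apply: ler_sum => s; rewrite andbT ltnS => ts.
have E : {ae P, forall x, U (s, x) * Z (s, x) = Y s x * Z (s, x)}.
  by apply: filterS UY => x /(_ _ ts) ->.
have LUs := LUZ s ts.
apply: Rintegral_ae_le => //; last by apply: filterS E => x ->.
apply: (L1_ae_le _ LUs); last by apply: filterS E => x ->.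
have [mY _] := Rinf_tT_bounded hF tT RY ts.
by apply: measurable_funM => //; exact: L1_measurable ((muI _ LZ).1 _ ts).
Qed.

End fixed_position.
End monetary_utility.

(** * Dual processes and duality *)

Section linear_bounds.
Context {R : realType}.

(** A large factor [k] outweighs the constant [e]; this is how the error [eps] disappears from the
    constraints on the density. *)
Lemma affine_ge0_slope (e v : R) : (forall k, 0 <= k -> 0 <= e + k * v) -> 0 <= v.
Proof.
move=> h; rewrite leNgt; apply/negP => v0.
have k0 : 0 <= (`|e| + 1) / - v by rewrite divr_ge0 ?addr_ge0// oppr_ge0 ltW.
have := h _ k0; rewrite invrN mulrN mulNr divfK ?lt_eqF//.
by have := ler_norm e; lra.
Qed.

Lemma affine_le_slope_eq (e u v : R) : (forall k, k * u <= e + k * v) -> u = v.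
Proof.
move=> h; apply/eqP; rewrite eq_le; apply/andP; split; rewrite -subr_ge0;
  apply: (@affine_ge0_slope e) => k _; [have := h k|have := h (- k)]; lra.
Qed.

End linear_bounds.

(** * From the supergradient to a scenario in [D_tT] *)

Section dual_element.
Context {d : measure_display} {T : measurableType d} {R : realType}.
Variables (P : probability T R) (F : nat -> set (set T)) (t TT : nat).
Variable phi : @process d T R -> T -> R.
Hypotheses (hF : filtration F) (tT : (t <= TT)%N).
Hypothesis hM : monetary_utility P F t TT phi.
Implicit Types (Y : @process d T R).

Local Notation L1 f := (P.-integrable setT (EFin \o f)).
Local Notation Rf := (Rinf_tT P F t TT).

Variables (X : @process d T R) (eps : R) (Z : nat -> T -> R).
Hypotheses (RX : Rf X) (GZ : forall s, Gmeas (F s) (Z s)).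
Hypothesis LZ : forall s, (t <= s <= TT)%N -> L1 (Z s).
Hypothesis hZ : forall Y, Rf Y -> \int[P]_x phi (fun s x => X s x + Y s x) x <=
  \int[P]_x phi X x + eps + \sum_(t <= s < TT.+1) \int[P]_x (Y s x * Z s x).

(** Adding [k >= 0] from time [s] alone, on the event where [Z s] is negative, cannot lower the
    utility. So [eps + k * v] is nonnegative for the integral [v] of [Z s] over that event, whatever
    [k]. *)
Lemma dual_density_ge0 s : (t <= s <= TT)%N -> {ae P, forall x, 0 <= Z s x}.
Proof.
move=> ts; have hs := filtration_sigma hF s.
pose N := ~` [set x | 0 <= Z s x].
have FN : F s N by apply: G_setC => //; exact: Gmeas_le (Gmeas_cst hs 0) (GZ s).
have mN := filtration_measurable hF FN.
have LNZ := L1_indic mN (LZ ts).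
have NZ x : \1_N x * Z s x <= 0.
  rewrite indicE; case: (boolP (x \in N)) => [|_]; last by rewrite mul0r.
  by rewrite inE /N /= => /negP; rewrite -ltNge mul1r => /ltW.
suff : 0 <= \int[P]_x (\1_N x * Z s x).
  move=> h.
  have LN : L1 (fun x => - 1 * (\1_N x * Z s x)) by exact: L1Z.
  have := Rintegral_eq0_ae LN.
  have -> : \int[P]_x (-1 * (\1_N x * Z s x)) = 0.
    apply/eqP; rewrite eq_le; apply/andP; split; first by rewrite RintegralZl//; lra.
    by apply: Rintegral_ge0 => x _; have := NZ x; lra.
  move=> /(_ (fun x => _) erefl) h'.
  have {}h' : {ae P, forall x, -1 * (\1_N x * Z s x) = 0} by apply: h' => x; have := NZ x; lra.
  apply: filterS h' => x /eqP; rewrite mulN1r oppr_eq0 indicE; case: (boolP (x \in N)).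
    by rewrite mul1r => _ /eqP ->.
  by rewrite notin_setE /N /= => /contrapT.
apply: (@affine_ge0_slope _ eps) => k k0.
pose Y : @process d T R := pi_tT t TT (fun u x => if u == s then k * \1_N x else 0).
have RY : Rf Y.
  exists (fun u x => if u == s then k * \1_N x else 0); split => //; split.
    move=> u; case: (eqVneq u s) => [->|_].
      by apply: GmeasM => //; [exact: Gmeas_cst|exact: Gmeas_indic].
    exact: (Gmeas_cst (filtration_sigma hF u)).
  exists k; apply: aeW => x u; case: ifP => _; last by rewrite normr0.
  by rewrite normrM (ger0_norm k0) ler_piMr//; case: (bounded_mfun_indic (R := R) mN).
have := hZ RY.
have -> : \sum_(t <= u < TT.+1) \int[P]_x (Y u x * Z u x) = k * \int[P]_x (\1_N x * Z s x).
  rewrite (bigD1_seq s) ?iota_uniq//=; last by rewrite mem_index_iota ltnS.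
  rewrite big_nat_cond big1 ?addr0; last first.
    move=> u /andP[/andP[tu]]; rewrite ltnS => uT us.
    rewrite (@eq_Rintegral _ _ _ P setT (fun=> 0)); first by rewrite Rintegral_cst// mul0r.
    by move=> x _; rewrite /Y /pi_tT tu (minn_idPl uT) (negbTE us) mul0r.
  rewrite -RintegralZl//; apply: eq_Rintegral => x _.
  move: (ts) => /andP[ts1 ts2].
  by rewrite /Y /pi_tT ts1 (minn_idPl ts2) eqxx mulrA.
have : \int[P]_x phi X x <= \int[P]_x phi (fun s x => X s x + Y s x) x.
  have RXY := Rinf_tT_add hF tT RX RY.
  apply: Rintegral_ae_le; [exact: (L1_phi hF hM)|exact: (L1_phi hF hM)|].
  apply: (phi_le hM) => //; apply: aeW => x u; rewrite lerDl /Y /pi_tT.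
  case: ifP => // _; case: ifP => // _; exact: mulr_ge0.
lra.
Qed.

(** Adding [k] on [A] from time [t] on changes the expected utility by exactly [k * P A]. Since [k]
    may have either sign, the slopes on the two sides agree. *)
Lemma dual_density_mass (A : set T) : F t A ->
  \int[P]_x (\1_A x * 1) = \int[P]_x (\1_A x * \sum_(t <= s < TT.+1) Z s x).
Proof.
move=> FA; have ht := filtration_sigma hF t; have mA := filtration_measurable hF FA.
have LA : L1 (\1_A : T -> R) by exact: (L1_bounded (bounded_mfun_indic mA)).
have -> : \int[P]_x (\1_A x * \sum_(t <= s < TT.+1) Z s x) =
    \sum_(t <= s < TT.+1) \int[P]_x (\1_A x * Z s x).
  transitivity (\int[P]_x (\sum_(t <= s < TT.+1) if (t <= s <= TT)%N then \1_A x * Z s x else 0)).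
    apply: eq_Rintegral => x _; rewrite mulr_sumr big_nat_cond [RHS]big_nat_cond.
    by apply: eq_bigr => s; rewrite andbT ltnS => ->.
  rewrite Rintegral_sum; last first.
    move=> s; case: (boolP (t <= s <= TT)%N) => ts; last exact: (@integrable0 _ _ _ P setT).
    exact: L1_indic mA (LZ ts).
  rewrite big_nat_cond [RHS]big_nat_cond.
  by apply: eq_bigr => s; rewrite andbT ltnS => ->.
apply: (@affine_le_slope_eq _ eps) => k.
pose m x : R := k * \1_A x.
have Gm : Gmeas (F t) m by apply: GmeasM => //; [exact: Gmeas_cst|exact: Gmeas_indic].
have bm : exists c : R, {ae P, forall x, `|m x| <= c}.
  exists `|k|; apply: aeW => x; rewrite normrM ler_piMr//.
  by case: (bounded_mfun_indic (R := R) mA).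
have RY := Rinf_tT_pay hF tT Gm bm.
have := hZ RY.
have RXY := Rinf_tT_add hF tT RX RY.
have -> : \int[P]_x phi (fun s x => X s x + (if (t <= s)%N then m x else 0)) x =
    \int[P]_x phi X x + k * \int[P]_x (\1_A x * 1).
  rewrite -RintegralZl//; last by under eq_fun do rewrite mulr1.
  have Lm : L1 (fun x => k * (\1_A x * 1)) by apply: L1Z; under eq_fun do rewrite mulr1.
  rewrite -RintegralD//; last exact: (L1_phi hF hM).
  apply: Rintegral_ae_eq; [exact: (L1_phi hF hM)|apply: L1D => //; exact: (L1_phi hF hM)|].
  by apply: filterS (phi_cash hM RX Gm bm) => x ->; rewrite /m mulr1.
have -> : \sum_(t <= s < TT.+1) \int[P]_x ((if (t <= s)%N then m x else 0) * Z s x) =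
    k * \sum_(t <= s < TT.+1) \int[P]_x (\1_A x * Z s x).
  rewrite mulr_sumr big_nat_cond [RHS]big_nat_cond; apply: eq_bigr => s.
  rewrite andbT ltnS => ts; rewrite -RintegralZl//; last exact: L1_indic mA (LZ ts).
  by apply: eq_Rintegral => x _; case/andP : ts => -> _; rewrite /m mulrA.
lra.
Qed.

(** Summation from [t] leaves an empty sum before [t], so the increment at [t] is [Z t]; stopping at
    [TT] makes the process a fixed point of [pi_tT]. *)
Definition dual_process : @process d T R :=
  fun s x => \sum_(t <= u < (minn s TT).+1) Z u x.

Lemma dual_process_pi : dual_process = pi_tT t TT dual_process.
Proof.
apply/funext => s; apply/funext => x; rewrite /pi_tT /dual_process -minnA minnn.
case: (leqP t s) => // st; rewrite big_geq//.
by rewrite (leq_trans _ st)// ltnS geq_minl.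
Qed.

Lemma delta_dual_process s x : delta dual_process s x =
  if (t <= s <= TT)%N then Z s x else 0.
Proof.
rewrite /delta /dual_process; case: s => [|s].
  rewrite min0n subr0 andbT leqn0; case: (eqVneq t 0%N) => [->|t0]; first by rewrite big_nat1.
  by rewrite big_geq// lt0n.
have [sT|] := boolP (s.+1 <= TT)%N; last rewrite -ltnNge => Ts.
  rewrite (minn_idPl sT) (minn_idPl (ltnW sT)) andbT.
  case: (leqP t s.+1) => ts; first by rewrite big_nat_recr//= addrAC subrr add0r.
  by rewrite !big_geq ?subr0//; exact: ltnW.
by rewrite (minn_idPr (ltnW Ts)) (minn_idPr (ltnSE Ts)) subrr andbF.
Qed.

Lemma dual_process_A1plus : A1plus P F dual_process.
Proof.
split; last first.
  move=> s; have [ts|ts] := boolP (t <= s <= TT)%N.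
    by apply: filterS (dual_density_ge0 ts) => x; rewrite delta_dual_process ts.
  by apply: aeW => x; rewrite delta_dual_process (negbTE ts).
split.
  move=> s; have hs := filtration_sigma hF s.
  rewrite (_ : dual_process s = fun x => \sum_(t <= u < (minn s TT).+1) if (u
    <= s)%N then Z u x else 0).
    apply: Gmeas_sum => // u; case: (leqP u s) => us; last exact: Gmeas_cst.
    exact: (Gmeas_mono hF us).
  apply/funext => x; rewrite /dual_process big_nat_cond [RHS]big_nat_cond.
  by apply: eq_bigr => u; rewrite andbT ltnS leq_min => /and3P[_ -> _].
have Ld s : L1 (delta dual_process s).
  have [ts|ts] := boolP (t <= s <= TT)%N.
    by rewrite (_ : delta _ _ = Z s); [exact: LZ|apply/funext => x; rewrite delta_dual_process ts].
  rewrite (_ : delta _ _ = fun=> 0); first exact: (@integrable0 _ _ _ P setT).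
  by apply/funext => x; rewrite delta_dual_process (negbTE ts).
rewrite integral_nneseries//; last first.
  by move=> n; apply/measurable_EFinP; apply: measurableT_comp => //; exact: L1_measurable (Ld n).
rewrite (nneseries_split _ TT.+1); last by move=> k _; apply: integral_ge0 => x _; rewrite lee_fin.
rewrite [X in (_ + X)%E]eseries0 ?adde0; last first.
  move=> i; rewrite add0n => Ti _; rewrite integral0_eq// => x _.
  by rewrite delta_dual_process [(i <= TT)%N]leqNgt Ti/= andbF normr0.
rewrite lte_sum_pinfty// => i _; rewrite -EFin_Rintegral ?ltry//.
exact: L1_abs (Ld i).
Qed.

Lemma dual_process_D : D_tT P F t TT dual_process.
Proof.
split; first by exists dual_process; split; [exact: dual_process_A1plus|exact: dual_process_pi].
have hs := filtration_sigma hF t.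
have SE : (fun x => \sum_(t <= s < TT.+1) 1 * delta dual_process s x) =
    (fun x => \sum_(t <= s < TT.+1) Z s x).
  apply/funext => x; rewrite big_nat_cond [RHS]big_nat_cond; apply: eq_bigr => s.
  by rewrite andbT ltnS => ts; rewrite delta_dual_process ts mul1r.
apply: (condexp_ae_eq hs (@filtration_measurable _ _ _ hF t)).
- exact: Gmeas_cst.
- exact: (L1_bounded (bounded_mfun_cst 1)).
- rewrite SE (_ : (fun x => _) = fun x => \sum_(t <= s < TT.+1) if (t <= s
  <= TT)%N then Z s x else 0).
    apply: L1_sum => s; case: (boolP (t <= s <= TT)%N) => ts; first exact: LZ.
    exact: (@integrable0 _ _ _ P setT).
  apply/funext => x; rewrite big_nat_cond [RHS]big_nat_cond; apply: eq_bigr => s.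
  by rewrite andbT ltnS => ->.
- move=> A FA; rewrite dual_density_mass//; apply: eq_Rintegral => x _.
  by congr (_ * _); rewrite -[RHS]/((fun x => _) x) SE.
Qed.

Lemma L1_delta_dual s : (t <= s <= TT)%N -> L1 (delta dual_process s).
Proof. exact: (D_L1_delta hF dual_process_D). Qed.

(** The test position [1_A (Y - X)] turns [X] into [Y] on [A], where [phi Y] is nonnegative. The
    scalar inequality thereby localises to every [A] in [F t]. *)
Lemma dual_process_bound Y (A : set T) : Rf Y -> {ae P, forall x, 0 <= phi Y x} -> F t A ->
  \int[P]_x (\1_A x * (pairing P F t TT X dual_process x - phi X x
     - pairing P F t TT Y dual_process x)) <= eps.
Proof.
move=> RY Y0 FA.
have FC := G_setC (filtration_sigma hF t) FA.
have mA := filtration_measurable hF FA; have mC := filtration_measurable hF FC.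
pose a := dual_process.
pose V : @process d T R := fun s x => \1_A x * (Y s x + -1 * X s x).
have RYX : Rf (fun s x => Y s x + -1 * X s x).
  exact: (Rinf_tT_add hF tT RY (Rinf_tT_cst hF tT (-1) RX)).
have RV : Rf V by exact: (Rinf_tT_indic hF tT FA RYX).
have bX := Rinf_tT_bounded hF tT RX; have bY := Rinf_tT_bounded hF tT RY.
have bNX := Rinf_tT_bounded hF tT (Rinf_tT_cst hF tT (-1) RX).
have bYX := Rinf_tT_bounded hF tT RYX; have bV := Rinf_tT_bounded hF tT RV.
have LX := L1_phi hF hM RX; have LY := L1_phi hF hM RY.
have Lpair W := L1_pairing_condexp P F t TT a W.
have := hZ RV.
have -> : \sum_(t <= s < TT.+1) \int[P]_x (V s x * Z s x) =
    \int[P]_x (\1_A x * (pairing P F t TT Y a x - pairing P F t TT X a x)).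
  transitivity (\int[P]_x (\1_A x * pairing P F t TT (fun s x => Y s x + -1 * X s x) a x));
    last first.
    apply: Rintegral_ae_eq; [apply: L1_indic => //; exact: Lpair|apply: L1_indic => //;
      apply: L1B; exact: Lpair|].
    have h1 := pairing_add hF L1_delta_dual bY bNX.
    have h2 := pairing_scale hF L1_delta_dual (-1) bX.
    by apply: filterS2 h1 h2 => x -> ->; rewrite mulN1r.
  rewrite (Rintegral_pairing hF L1_delta_dual FA bYX).
  transitivity (\int[P]_x (\sum_(t <= s < TT.+1) if (t <= s
    <= TT)%N then V s x * delta a s x else 0)).
    rewrite Rintegral_sum; last first.
      move=> s; case: (boolP (t <= s <= TT)%N) => ts; last exact: (@integrable0 _ _ _ P setT).
      exact: (L1_coord L1_delta_dual bV ts).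
    rewrite big_nat_cond [RHS]big_nat_cond; apply: eq_bigr => s.
    rewrite andbT ltnS => ts; rewrite ts; apply: eq_Rintegral => x _.
    by rewrite /a delta_dual_process ts.
  apply: eq_Rintegral => x _; rewrite mulr_sumr big_nat_cond [RHS]big_nat_cond.
  by apply: eq_bigr => s; rewrite andbT ltnS => ->; rewrite /V mulrA.
have VE : (fun s x => X s x + V s x) = (fun s x => \1_A x * Y s x + \1_(~` A) x * X s x).
  apply/funext => s; apply/funext => x; rewrite /V !indicE in_setC.
  by case: (_ \in _) => /=; ring.
have -> : \int[P]_x phi (fun s x => X s x + V s x) x =
    (\int[P]_x (\1_A x * phi Y x)) + \int[P]_x (\1_(~` A) x * phi X x).
  rewrite VE -RintegralD ?L1_indic//; apply: Rintegral_ae_eq.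
  - by apply: (L1_phi hF hM); exact: (Rinf_tT_paste hF tT FA RY RX).
  - by apply: L1D; exact: L1_indic.
  - exact: (phi_paste hF tT hM FA RY RX).
have -> : \int[P]_x phi X x = (\int[P]_x (\1_A x * phi X x)) + \int[P]_x (\1_(~` A) x * phi X x).
  rewrite -RintegralD ?L1_indic//; apply: eq_Rintegral => x _; rewrite !indicE in_setC.
  by case: (_ \in _) => /=; ring.
have : 0 <= \int[P]_x (\1_A x * phi Y x).
  have <- : \int[P]_x (0 : R) = 0 by rewrite Rintegral_cst// mul0r.
  apply: Rintegral_ae_le; [exact: (@integrable0 _ _ _ P setT)|exact: L1_indic|].
  by apply: filterS Y0 => x h; apply: mulr_ge0.
have -> : \int[P]_x (\1_A x * (pairing P F t TT X a x - phi X x - pairing P F t TT Y a x)) =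
   - (\int[P]_x (\1_A x * phi X x)) - \int[P]_x (\1_A x * (pairing P F t TT Y a x - pairing
     P F t TT X a x)).
  have -> : - (\int[P]_x (\1_A x * phi X x)) = \int[P]_x (-1 * (\1_A x * phi X x)).
    by rewrite RintegralZl ?L1_indic// mulN1r.
  have LB : L1 (fun x => pairing P F t TT Y a x - pairing P F t TT X a x) by apply: L1B;
    exact: Lpair.
  rewrite -RintegralB ?L1Z ?L1_indic//.
  by apply: eq_Rintegral => x _; ring.
lra.
Qed.

(** The event where the gap is nonnegative belongs to [F t], and on it the localised integral is
    that of the positive part. *)
Lemma dual_process_bound_pos Y : Rf Y -> {ae P, forall x, 0 <= phi Y x} ->
  \int[P]_x Num.max 0 (pairing P F t TT X dual_process x - phi X x
     - pairing P F t TT Y dual_process x) <= eps.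
Proof.
move=> RY Y0; pose u x := pairing P F t TT X dual_process x - phi X x.
pose v := pairing P F t TT Y dual_process.
have hs := filtration_sigma hF t.
have Gu : Gmeas (F t) u.
  by apply: GmeasB => //; [exact: (Gmeas_pairing P t TT hF)|exact: (Gmeas_phi hM)].
have Gv : Gmeas (F t) v by exact: (Gmeas_pairing P t TT hF).
have FA := Gmeas_le hs Gv Gu.
apply: le_trans (dual_process_bound RY Y0 FA).
rewrite le_eqVlt; apply/orP; left; apply/eqP; apply: eq_Rintegral => x _.
rewrite indicE -/(u x) -/(v x); case: (boolP (x \in _)); rewrite ?inE ?notin_setE /=.
  by move=> vu; rewrite mul1r max_r// subr_ge0.
by move=> /negP; rewrite -ltNge mul0r => /ltW uv; rewrite max_l// subr_le0.
Qed.

End dual_element.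

(** * Weak duality and nearly optimal scenarios *)

Section duality.
Context {d : measure_display} {T : measurableType d} {R : realType}.
Variables (P : probability T R) (F : nat -> set (set T)) (t TT : nat).
Variable phi : @process d T R -> T -> R.
Hypotheses (hF : filtration F) (tT : (t <= TT)%N).
Hypothesis hM : monetary_utility P F t TT phi.
Implicit Types (X Y a : @process d T R).

Local Notation L1 f := (P.-integrable setT (EFin \o f)).
Local Notation Rf := (Rinf_tT P F t TT).
Local Notation acc := (accept P F t TT phi).
Local Notation pr := (pairing P F t TT).

Lemma measurable_pairing X a : measurable_fun setT (fun x => (pr X a x)%:E).
Proof. by apply/measurable_EFinP; exact: (Gmeas_filtration hF (Gmeas_pairing P t TT hF a X)). Qed.

Lemma accept_neq0 X : Rf X -> exists Y, acc Y.
Proof.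
move=> RX; have [F0 _ _] := filtration_sigma hF t.
exists (fun s x => \1_set0 x * X s x); split; first exact: (Rinf_tT_indic hF tT F0).
have [_ loc _ _] := hM; apply: filterS (loc _ _ F0 RX) => x ->.
by rewrite indic0 mul0r.
Qed.

(** Pasting on the event where the first pairing is the smaller makes the pairings of accepted
    positions directed downwards. *)
Lemma accept_paste_min a Y1 Y2 : D_tT P F t TT a -> acc Y1 -> acc Y2 ->
  exists2 Y, acc Y & {ae P, forall x, pr Y a x = Num.min (pr Y1 a x) (pr Y2 a x)}.
Proof.
move=> Da [R1 p1] [R2 p2]; have hs := filtration_sigma hF t.
have La s : (t <= s <= TT)%N -> L1 (delta a s) by exact: (D_L1_delta hF Da).
pose A := [set x | pr Y1 a x <= pr Y2 a x].
have FA : F t A by apply: (Gmeas_le hs); exact: (Gmeas_pairing P t TT hF).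
have FC := G_setC hs FA.
exists (fun s x => \1_A x * Y1 s x + \1_(~` A) x * Y2 s x).
  split; first exact: (Rinf_tT_paste hF tT FA R1 R2).
  apply: filterS3 (phi_paste hF tT hM FA R1 R2) p1 p2 => x -> h1 h2.
  by apply: addr_ge0; exact: mulr_ge0.
have h0 := pairing_add hF La (Rinf_tT_bounded hF tT (Rinf_tT_indic hF tT FA R1))
  (Rinf_tT_bounded hF tT (Rinf_tT_indic hF tT FC R2)).
have h1 := pairing_indic hF La FA (Rinf_tT_bounded hF tT R1).
have h2 := pairing_indic hF La FC (Rinf_tT_bounded hF tT R2).
apply: filterS3 h0 h1 h2 => x -> -> ->; rewrite !indicE in_setC.
case: (boolP (x \in A)); rewrite ?inE ?notin_setE /A /= => h; rewrite mul1r mul0r.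
  by rewrite addr0 min_l.
by rewrite add0r min_r//; move/negP : h; rewrite -ltNge => /ltW.
Qed.

Lemma phi_sharp_le a Y : acc Y -> {ae P, forall x, (phi_sharp P F t TT phi a x <= (pr Y a x)%:E)%E}.
Proof.
move=> aY; rewrite /phi_sharp /essinf; set S := (X in esssup P X).
have S0 : S !=set0.
  by exists (fun y => - (pr Y a y)%:E)%E; exists (fun y => (pr Y a y)%:E) => //; exists Y.
have mS f : S f -> measurable_fun setT f.
  move=> [_ [Y' _ <-] <-]; apply: measurableT_comp => //; exact: measurable_pairing.
have [_ ub _] := esssupP P S0 mS.
have /ub : S (fun y => - (pr Y a y)%:E)%E by exists (fun y => (pr Y a y)%:E) => //; exists Y.
by apply: filterS => x; rewrite leeNl.
Qed.

(* phi_sharp is tested on 1_{q <= p} (- X - q) for rational q, with p = phi (- X);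
   letting q increase to p replaces pulling p out of the conditional expectation. *)
Lemma weak_duality X a : Rf X -> D_tT P F t TT a ->
  {ae P, forall x, ((pr X a x)%:E + phi_sharp P F t TT phi a x
     <= (Psi_ins phi X x)%:E)%E}.
Proof.
move=> RX Da; have hs := filtration_sigma hF t.
have La s : (t <= s <= TT)%N -> L1 (delta a s) by exact: (D_L1_delta hF Da).
pose NX : @process d T R := fun s x => - X s x.
have RNX : Rf NX by exact: (Rinf_tT_opp hF tT).
pose p := phi NX.
have Gp : Gmeas (F t) p by exact: (Gmeas_phi hM).
have key : {ae P, forall x, forall q : rat, ratr q <= p x ->
    (phi_sharp P F t TT phi a x <= (- pr X a x - ratr q)%:E)%E}.
  apply: ae_forall_countable => q; set c : R := ratr q.
  pose A := [set x | c <= p x].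
  have FA : F t A by exact: (Gmeas_le hs (Gmeas_cst hs c) Gp).
  pose V : @process d T R := fun s x => NX s x + (if (t <= s)%N then - c else 0).
  have RV : Rf V by exact: (Rinf_tT_add hF tT RNX (Rinf_tT_pay_cst P hF tT (- c))).
  pose Y : @process d T R := fun s x => \1_A x * V s x.
  have RY : Rf Y by exact: (Rinf_tT_indic hF tT FA RV).
  have aY : acc Y.
    split => //; have [_ loc _ _] := hM.
    apply: filterS2 (loc _ _ FA RV) (phi_cash_cst hF hM (- c) RNX) => x -> ->.
    rewrite indicE; case: (boolP (x \in A)); last by rewrite mul0r.
    by rewrite inE /A /= mul1r subr_ge0.
  have b1 := @ae_bounded_coords_cst _ _ _ P t TT (1 : R).
  have bc := @ae_bounded_coords_cst _ _ _ P t TT (- c * 1).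
  have bpay := Rinf_tT_bounded hF tT (Rinf_tT_pay_cst P hF tT (- c)).
  have bX := Rinf_tT_bounded hF tT RX; have bNX := Rinf_tT_bounded hF tT RNX.
  have h1 := pairing_indic hF La FA (Rinf_tT_bounded hF tT RV).
  have h2 := pairing_add hF La bNX bpay.
  have h3 : {ae P, forall x, pr NX a x = - pr X a x}.
    apply: filterS (pairing_scale hF La (-1) bX) => x; rewrite mulN1r => <-.
    by congr (pairing P F t TT _ a x); apply/funext => s; apply/funext => y; rewrite mulN1r.
  (* On the window the stream is [- c] times the constant 1, whose pairing with [a] is 1 by
     membership in [D_tT]. *)
  have h4 : {ae P, forall x, pr (fun s _ => if (t <= s)%N then - c else 0) a x = - c}.
    have h5 : {ae P, forall x, pr (fun s _ => if (t <= s)%N then - c else 0) a x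
      = pr (fun _ _ => - c * 1) a x}.
      apply: (pairing_ae_congr hF La bpay bc); apply: aeW => x s /andP[-> _].
      by rewrite mulr1.
    have h6 := pairing_scale hF La (- c) b1.
    by have [_ h7] := Da; apply: filterS3 h5 h6 h7 => x -> -> ->; rewrite mulr1.
  have h34 : {ae P, forall x, pr V a x = - pr X a x - c}.
    by apply: filterS3 h2 h3 h4 => x -> -> ->.
  apply: filterS3 (phi_sharp_le a aY) h1 h34 => x h1' h2' h3' cp.
  by move: h1'; rewrite [pr Y a x]h2' h3' indicE mem_set// mul1r.
apply: filterS key => x hx; rewrite /Psi_ins -/NX -/p.
(* A rational just below [p x] refutes both a finite value that is too large and the value [+oo]. *)
move: hx; case: (phi_sharp _ _ _ _ _ _ _) => [r| |] hx.
- rewrite -EFinD lee_fin leNgt; apply/negP => h.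
  have lt : - pr X a x - r < p x by lra.
  have [q] := rat_in_itvoo lt; rewrite in_itv/= => /andP[q1 q2].
  by have := hx q (ltW q2); rewrite lee_fin; lra.
- have lt : p x - 1 < p x by lra.
  have [q] := rat_in_itvoo lt; rewrite in_itv/= => /andP[q1 q2].
  by have := hx q (ltW q2); rewrite leye_eq.
- by rewrite addeNy leNye.
Qed.

Hypothesis hC : concave_mu P F t TT phi.
Hypothesis hD : cont_bdd_decr P F t TT phi.

(** The essential infimum is a countable one, and running minima of pairings come from single
    accepted positions. The expected shortfall is therefore at most [eps] along the sequence and, by
    monotone convergence, for its supremum [v]. *)
Lemma near_dual X (eps : R) : Rf X -> 0 < eps ->
  exists a, D_tT P F t TT a /\ exists v : T -> \bar R,
    [/\ measurable_fun setT v, forall x, (0 <= v x)%E, (\int[P]_x v x <= eps%:E)%E &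
     {ae P, forall x, ((pr X a x - phi X x)%:E - v x <= phi_sharp P F t TT phi a x)%E}].
Proof.
move=> RX eps0; have hs := filtration_sigma hF t.
have [Z [GZ LZ hZ]] := dual_density hF tT hM hC hD RX eps0.
pose a := dual_process t TT Z.
have Da : D_tT P F t TT a by exact: (dual_process_D hF tT hM RX GZ LZ hZ).
exists a; split => //.
rewrite /phi_sharp /essinf; set S := (X in esssup P X).
have S0 : S !=set0.
  have [Y aY] := accept_neq0 RX.
  by exists (fun y => - (pr Y a y)%:E)%E; exists (fun y => (pr Y a y)%:E) => //; exists Y.
have mS f : S f -> measurable_fun setT f.
  move=> [_ [Y' _ <-] <-]; apply: measurableT_comp => //; exact: measurable_pairing.
have [g_ Sg hg] := esssup_attained_seq P S0 mS.
have /choice[Y_ YP] k : exists Y, acc Y /\ g_ k = (fun y => - (pr Y a y)%:E)%E.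
  by have [_ [Y aY <-] <-] := Sg k; exists Y.
(* Running minimum of the first [k + 1] pairings; it decreases in [k], so the shortfalls [v_ k]
   increase. *)
pose m := fix m k : T -> R := if k is k'.+1 then (fun x => Num.min (m k' x) (pr (Y_ k) a x))
  else pr (Y_ 0%N) a.
have exW k : exists2 W, acc W & {ae P, forall x, pr W a x = m k x}.
  elim: k => [|k [W aW Wm]]; first by exists (Y_ 0%N); [case: (YP 0%N)|exact: aeW].
  have [W' aW' h] := accept_paste_min Da aW (YP k.+1).1.
  by exists W' => //; apply: filterS2 h Wm => x -> ->.
have mY k x : m k x <= pr (Y_ k) a x.
  by case: k => [|k] //=; rewrite ge_min lexx orbT.
have m_dec k x : m k.+1 x <= m k x by rewrite /= ge_min lexx.
have mm k : measurable_fun setT (m k).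
  have mp Y : measurable_fun setT (pr Y a) by apply/measurable_EFinP; exact: measurable_pairing.
  by elim: k => [|k ih] //=; exact: measurable_minr.
pose u x := pr X a x - phi X x.
have mu : measurable_fun setT u.
  apply: (Gmeas_filtration hF (s := t)); apply: GmeasB => //.
    exact: (Gmeas_pairing P t TT hF).
  exact: (Gmeas_phi hM).
pose v_ k x := (Num.max 0 (u x - m k x))%:E.
have v_ge0 k x : (0 <= v_ k x)%E by rewrite lee_fin le_max lexx.
have mv_ k : measurable_fun setT (v_ k).
  by apply/measurable_EFinP; apply: measurable_maxr => //; exact: measurable_funB.
have v_nd x : nondecreasing_seq (v_ ^~ x).
  apply/nondecreasing_seqP => k; rewrite lee_fin.
  by have := m_dec k x; rewrite !maxEle; case: ifP; case: ifP; lra.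
pose v x := ereal_sup (range (v_ ^~ x)).
have v_v k x : (v_ k x <= v x)%E by apply: ereal_sup_ubound; exists k.
have vE x : limn (v_ ^~ x) = v x.
  by apply/cvg_lim => //; exact: ereal_nondecreasing_cvgn.
have Iv k : (\int[P]_x v_ k x <= eps%:E)%E.
  have [W [RW W0] Wm] := exW k.
  have := dual_process_bound_pos hF tT hM RX GZ LZ hZ RW W0.
  rewrite -lee_fin EFin_Rintegral; last first.
    apply: (@L1_le _ _ _ P _ (fun x => pr X a x - phi X x - pr W a x)).
    - apply: measurable_maxr => //; apply: measurable_funB => //.
      by apply/measurable_EFinP; exact: measurable_pairing.
    - apply: L1B; last exact: L1_pairing_condexp.
      by apply: L1B; [exact: L1_pairing_condexp|exact: (L1_phi hF hM)].
    - by move=> x; rewrite maxEle; case: ifP => //; rewrite normr0.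
  apply: le_trans; apply: ae_ge0_le_integral => //.
  - by move=> x _; rewrite lee_fin le_max lexx.
  - apply/measurable_EFinP; apply: measurable_maxr => //; apply: measurable_funB => //.
    by apply/measurable_EFinP; exact: measurable_pairing.
  - by apply: filterS Wm => x h _; rewrite /v_ -h.
exists v; split.
- have -> : v = (fun x => esups (v_ ^~ x) 0%N).
    by apply/funext => x; rewrite /v /esups /sdrop; congr ereal_sup; apply/seteqP;
      split => _ [k _ <-]; exists k.
  exact: measurable_fun_esups.
- by move=> x; exact: le_trans (v_ge0 0%N x) (v_v 0%N x).
- under eq_integral do rewrite -vE.
  rewrite monotone_convergence//; apply: lime_le; last exact: nearW.
  apply: ereal_nondecreasing_is_cvgn => k l kl.
  by apply: ge0_le_integral => // x _; exact: v_nd.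
- apply: filterS hg => x ->; rewrite leeNr; apply: ge_ereal_sup => _ [k _ <-].
  have [_ ->] := YP k; rewrite leeN2 -/(u x).
  have : ((u x - pr (Y_ k) a x)%:E <= v x)%E.
    apply: le_trans (v_v k x); rewrite lee_fin le_max; apply/orP; right.
    by rewrite lerD2l lerN2 mY.
  case: (v x) => [r| |] //=; rewrite ?lee_fin; first by lra.
  by rewrite addeNy leNye.
Qed.

End duality.

(** The indices [k i] vary independently: with the first one fixed, the remaining sums are bounded
    by [c] minus its term, and induction applies. *)
Lemma sum_ereal_sup_le {R : realType} n (u : 'I_n -> nat -> R) (c : \bar R) :
  (forall k : 'I_n -> nat, ((\sum_(i < n) u i (k i))%:E <= c)%E) ->
  (\sum_(i < n) ereal_sup (range (fun j => (u i j)%:E)) <= c)%E.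
Proof.
elim: n u c => [u c /(_ (fun=> 0%N))|n ih u c h]; first by rewrite !big_ord0.
rewrite big_ord_recl; set S := (\sum_(i < n) _)%E.
have S_le j : (S <= c - (u ord0 j)%:E)%E.
  apply: ih => k; rewrite leeBrDr// -EFinD.
  have := h (fun i => if unlift ord0 i is Some i' then k i' else j).
  rewrite big_ord_recl unlift_none addrC.
  by under eq_bigr do rewrite liftK.
have SNy : S != -oo%E.
  rewrite -ltNye; apply: (@lt_le_trans _ _ (\sum_(i < n) u (lift ord0 i) 0%N)%:E);
    first exact: ltNyr.
  by rewrite -sumEFin; apply: lee_sum => i _; apply: ereal_sup_ubound; exists 0%N.
case ES : S SNy => [s| |] // _; last first.
  by have := S_le 0%N; rewrite ES leye_eq; case: (c) => //= _; rewrite leey.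
rewrite -leeBrDr//; apply: ge_ereal_sup => _ [j _ <-].
by have := S_le j; rewrite ES leeBrDr// addeC -leeBrDr.
Qed.

(** The summand [f] stands for [phi_sharp], which may be infinite: [+oo] forces [c] to be [+oo], and
    [-oo] makes the left side [-oo]. *)
Lemma avg_ereal_sup_le {R : realType} n (u : 'I_n -> nat -> R) (f c : \bar R) :
  (0 < n)%N ->
  (forall k : 'I_n -> nat, ((n%:R^-1 * \sum_(i < n) u i (k i))%:E + f <= c)%E) ->
  ((n%:R^-1)%:E * (\sum_(i < n) ereal_sup (range (fun j => (u i j)%:E))) + f <= c)%E.
Proof.
move=> n0 h; have n0' : 0 < n%:R :> R by rewrite ltr0n.
case: f h => [f| |] h.
- rewrite -leeBrDr// lee_pdivrMl//; apply: sum_ereal_sup_le => k.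
  by have := h k; rewrite -leeBrDr// EFinM lee_pdivrMl.
- by have := h (fun=> 0%N); rewrite addey// leye_eq => /eqP ->; rewrite leey.
- by rewrite addeNy leNye.
Qed.

Section ae_limits.
Context {d : measure_display} {T : measurableType d} {R : realType}.
Variable P : probability T R.

(** Errors with integrals at most [1/(n+1)] have an infimum of integral zero, hence 0 a.e.; a strict
    gap between [Z] and [f] would keep them all above a positive constant. *)
Lemma ae_le_of_small_error (f : T -> R) (Z : T -> \bar R) :
  (forall eps : R, 0 < eps -> exists v : T -> \bar R,
    [/\ measurable_fun setT v, forall x, (0 <= v x)%E, (\int[P]_x v x <= eps%:E)%E &
     {ae P, forall x, ((f x)%:E - v x <= Z x)%E}]) ->
  {ae P, forall x, ((f x)%:E <= Z x)%E}.
Proof.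
move=> h.
have /choice[v_ vP] n := h n.+1%:R^-1 ltac:(by rewrite invr_gt0 ltr0n).
pose w x := einfs (v_ ^~ x) 0%N.
have mw : measurable_fun setT w by apply: measurable_fun_einfs => n; case: (vP n).
have w_v n x : (w x <= v_ n x)%E by apply: ereal_inf_lbound; exists n.
have w0 x : (0 <= w x)%E by apply: le_ereal_inf_tmp => _ [n _ <-]; case: (vP n).
have Iw : (\int[P]_x `|w x| = 0)%E.
  under eq_integral do rewrite gee0_abs//.
  apply/eqP; rewrite eq_le integral_ge0// andbT.
  apply/lee_addgt0Pr => e e0; rewrite add0e.
  pose n := Num.bound e^-1.
  have ne : n.+1%:R^-1 <= e.
    rewrite invf_ple ?posrE//; apply: le_trans (ltW (archi_boundP _)) _.
      by rewrite invr_ge0 ltW.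
    by rewrite ler_nat.
  have [mv v0 Iv _] := vP n.
  apply: (@le_trans _ _ (\int[P]_x v_ n x)%E); first exact: ge0_le_integral.
  by apply: le_trans Iv _; rewrite lee_fin.
have aw := (ae_eq_integral_abs P measurableT mw).1 Iw.
have af : {ae P, forall x, forall n, ((f x)%:E - v_ n x <= Z x)%E}.
  by apply: ae_foralln => n; case: (vP n).
apply: filterS2 aw af => x /(_ I) w0x hx; rewrite leNgt; apply/negP => Zf.
have [e e0 eZ] : exists2 e : R, 0 < e & (Z x + e%:E <= (f x)%:E)%E.
  case: (Z x) Zf => [z| |] //; last by exists 1 => //; rewrite leNye.
  by rewrite lte_fin => zf; exists (f x - z); rewrite ?subr_gt0// -EFinD lee_fin; lra.
have : (e%:E <= w x)%E.
  apply: le_ereal_inf_tmp => _ [n _ <-]; have := hx n; have [_ v0 _ _] := vP n.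
  move: (v0 x) eZ; case: (v_ n x) => [v| |] //; last by move=> *; rewrite leey.
  by case: (Z x) => [z| |] //; rewrite -?EFinD ?lee_fin// => _; lra.
by rewrite w0x lee_fin leNgt e0.
Qed.

End ae_limits.

(** * Comparison of the two suprema and the worst case portfolio *)

Theorem theorem3p1 (d : measure_display) (T : measurableType d) (R : realType)
  (P : probability T R) (F : nat -> set (set T)) (t TT : nat)
  (phi : process -> T -> R) (n : nat) (X : 'I_n -> process) :
  filtration F -> (t <= TT)%N ->
  monetary_utility P F t TT phi -> concave_mu P F t TT phi ->
  law_invariant P F t TT phi -> cont_bdd_decr P F t TT phi ->
  (0 < n)%N -> (forall i, Rinf_tT P F t TT (X i)) ->
  (* (i) *)
  (exists Z, is_esssup P (worst_family P F t TT phi X) Z /\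
             is_esssup P [set avg_risk P F t TT phi X a | a in D_tT P F t TT] Z)
  /\
  (* (ii) *)
  (forall (a0 : process) (Xbar : 'I_n -> process),
     worst_scenario P F t TT phi X a0 ->
     (forall i, Rinf_tT P F t TT (Xbar i) /\ same_law P t TT (Xbar i) (X i)) ->
     comonotone P F t TT a0 Xbar ->
     is_esssup P (worst_family P F t TT phi X)
       (fun x => (Psi_ins phi (avg_proc Xbar) x)%:E)).
Proof.
move=> hF tT hM hC _ hD n0 RX.
pose S1 := worst_family P F t TT phi X.
pose S2 := [set avg_risk P F t TT phi X a | a in D_tT P F t TT].
pose L i := [set Xt | Rinf_tT P F t TT Xt /\ same_law P t TT Xt (X i)].
have LX i : L i (X i) by split.
have S1_0 : S1 !=set0.
  by exists (fun x => (Psi_ins phi (avg_proc X) x)%:E); exists X.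
have mPsi Y : Rinf_tT P F t TT Y -> measurable_fun setT (fun x => (Psi_ins phi Y x)%:E).
  move=> RY; apply/measurable_EFinP; apply: measurableT_comp => //.
  exact: (Gmeas_filtration hF (Gmeas_phi hM (Rinf_tT_opp hF tT RY))).
have Ravg Xt : (forall i, L i (Xt i)) -> Rinf_tT P F t TT (avg_proc Xt).
  by move=> hXt; apply: (Rinf_tT_avg hF tT) => i; case: (hXt i).
have mS1 f : S1 f -> measurable_fun setT f.
  by move=> [Xt hXt <-]; apply: mPsi; exact: Ravg.
have pair_avg a Xt : D_tT P F t TT a -> (forall i, L i (Xt i)) ->
    {ae P, forall x, pairing P F t TT (avg_proc Xt) a x =
       n%:R^-1 * \sum_(i < n) pairing P F t TT (Xt i) a x}.
  move=> Da hXt.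
  have La s : (t <= s <= TT)%N -> P.-integrable setT (EFin \o delta a s)
    by exact: (D_L1_delta hF Da).
  have RXt i : Rinf_tT P F t TT (Xt i) by case: (hXt i).
  have h1 := pairing_sum hF La (fun i => Rinf_tT_bounded hF tT (RXt i)).
  have h2 := pairing_scale hF La n%:R^-1 (Rinf_tT_bounded hF tT (Rinf_tT_sum hF tT RXt)).
  by apply: filterS2 h1 h2 => x <- <-.
pose SL a i := [set (fun x => (pairing P F t TT Xt a x)%:E) | Xt in L i].
have SL_0 a i : SL a i !=set0.
  by exists (fun x => (pairing P F t TT (X i) a x)%:E); exists (X i).
have mSL a i f : SL a i f -> measurable_fun setT f.
  by move=> [Xt _ <-]; exact: measurable_pairing.
have Psi_ub a i Xt : L i Xt ->
    {ae P, forall x, ((pairing P F t TT Xt a x)%:E <= Psi_a P F t TT a (X i) x)%E}.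
  move=> hXt; have [_ ub _] := esssupP P (SL_0 a i) (@mSL a i).
  by apply: ub; exists Xt.
have [Z1 ub1 lb1] := esssupP P S1_0 mS1.
set Z := esssup P S1 in Z1 ub1 lb1.
have E2 : is_esssup P S2 Z.
  split => //.
    (* Each [Psi_a] is a countable supremum over rearrangements [Xk (i, j)] of [X i], and any choice
       of one rearrangement per [i] is an admissible family, so weak duality bounds it by [Z]. *)
    move=> _ [a Da <-].
    have /choice[g_ gP] i : exists g : nat -> T -> \bar R, (forall k, SL a i (g k)) /\
        {ae P, forall x, Psi_a P F t TT a (X i) x = ereal_sup (range (g ^~ x))}.
      by have [g Sg hg] := esssup_attained_seq P (SL_0 a i) (@mSL a i); exists g.
    have /choice[Xk XkP] (ik : 'I_n * nat) : exists Xt, L ik.1 Xt /\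
        g_ ik.1 ik.2 = (fun x => (pairing P F t TT Xt a x)%:E).
      by have [/(_ ik.2)[Xt LXt <-] _] := gP ik.1; exists Xt.
    (* Index choices are taken in a finite-function type because it is countable, which keeps the
       union of the exceptional sets null. *)
    have h1 : {ae P, forall x, forall k : {ffun 'I_n -> nat},
        ((n%:R^-1 * \sum_(i < n) pairing P F t TT (Xk (i, k i)) a x)%:E
           + phi_sharp P F t TT phi a x <= Z x)%E}.
      apply: ae_forall_countable => k.
      pose Xt i := Xk (i, k i).
      have hXt i : L i (Xt i) by case: (XkP (i, k i)).
      have h2 := weak_duality hF tT hM (Ravg _ hXt) Da.
      have h3 : {ae P, forall x, ((Psi_ins phi (avg_proc Xt) x)%:E <= Z x)%E}.
        by apply: ub1; exists Xt.
      apply: filterS3 h2 h3 (pair_avg _ _ Da hXt) => x h2 h3 h4.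
      by apply: le_trans h3; rewrite -h4.
    have h5 : {ae P, forall x, forall i, Psi_a P F t TT a (X i) x = ereal_sup (range (g_ i ^~ x))}.
      by apply: ae_forall_countable => i; case: (gP i).
    apply: filterS2 h1 h5 => x h1 h5; rewrite /avg_risk.
    have -> : (\sum_(i < n) Psi_a P F t TT a (X i) x =
       \sum_(i < n) ereal_sup (range (fun j => (pairing P F t TT (Xk (i, j)) a x)%:E)))%E.
      apply: eq_bigr => i _; rewrite h5 (_ : g_ i ^~ x
        = fun j => (pairing P F t TT (Xk (i, j)) a x)%:E)//.
      by apply/funext => j; have [_ /= ->] := XkP (i, j).
    apply: avg_ereal_sup_le => // k; have := h1 [ffun i => k i].
    by under eq_bigr do rewrite ffunE.
  (* Converse bound: a scenario nearly optimal for the negated average has average risk at least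
     [Psi_ins] of the average, up to an error of small expectation. *)
  move=> Z' mZ' hZ'; apply: lb1 => // _ [Xt hXt <-].
  apply: ae_le_of_small_error => eps eps0.
  have RY := Ravg _ hXt.
  have [a [Da [v [mv v0 Iv hv]]]] := near_dual hF tT hM hC hD (Rinf_tT_opp hF tT RY) eps0.
  exists v; split => //.
  have La s : (t <= s <= TT)%N -> P.-integrable setT (EFin \o delta a s)
    by exact: (D_L1_delta hF Da).
  have h1 : {ae P, forall x, pairing P F t TT (fun s x => - avg_proc Xt s x) a x
      = - pairing P F t TT (avg_proc Xt) a x}.
    apply: filterS (pairing_scale hF La (-1) (Rinf_tT_bounded hF tT RY)) => x; rewrite mulN1r => <-.
    by congr (pairing P F t TT _ a x); apply/funext => s; apply/funext => y; rewrite mulN1r.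
  have h2 : {ae P, forall x, (avg_risk P F t TT phi X a x <= Z' x)%E} by apply: hZ'; exists a.
  have h3 : {ae P, forall x, forall i, ((pairing P F t TT (Xt i) a x)%:E
    <= Psi_a P F t TT a (X i) x)%E}.
    by apply: ae_forall_countable => i; exact: Psi_ub.
  have h4 := pair_avg _ _ Da hXt.
  have h5 : {ae P, forall x, ((pairing P F t TT (avg_proc Xt) a x)%:E + phi_sharp P F t TT phi a x
      <= Z' x)%E}.
    apply: filterS3 h2 h3 h4 => x h2 h3 h4; apply: le_trans h2; rewrite /avg_risk leeD2r//.
    rewrite h4 EFinM lee_pmul2l// ?lte_fin ?invr_gt0 ?ltr0n// -sumEFin.
    exact: lee_sum.
  apply: filterS3 h1 hv h5 => x h1 hv h5; apply: le_trans h5.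
  move: hv; rewrite h1 /Psi_ins => hv.
  apply: le_trans (leeD2l _ hv); rewrite addeA -EFinD.
  by rewrite leeD2r// lee_fin; lra.
split; first by exists Z.
move=> a0 Xbar [Da0 worst] hXbar [com _].
have RY := Ravg _ hXbar.
split; first exact: mPsi.
  move=> f S1f; have h1 := ub1 _ S1f.
  (* [E2] exhibits an essential supremum of [S2], so the chosen one is genuine and agrees with [Z]
     a.e. *)
  have h2 : {ae P, forall x, esssup P S2 x = Z x}.
    apply: (is_esssup_unique _ E2); rewrite /esssup; case: pselect => [h|[]]; first by case: cid.
    by exists Z.
  have h3 := weak_duality hF tT hM RY Da0.
  have h4 := pair_avg _ _ Da0 hXbar.
  (* [Psi_a] depends only on the law, so comonotonicity, stated for [Xbar i], evaluates it at
     [X i]. *)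
  have PsiE i : Psi_a P F t TT a0 (Xbar i) = Psi_a P F t TT a0 (X i).
    rewrite /Psi_a; congr esssup; congr image; apply/seteqP.
    have [_ sl] := hXbar i.
    by split => Y [RY' slY]; split => // C hC'; rewrite slY// sl.
  have h5 : {ae P, forall x, forall i, Psi_a P F t TT a0 (X i) x
    = (pairing P F t TT (Xbar i) a0 x)%:E}.
    by apply: ae_forall_countable => i; rewrite -PsiE.
  (* At the worst scenario [Z] equals the average risk, which comonotonicity turns into the pairing
     of the average plus the penalty; weak duality at [a0] closes the chain. *)
  have h6 : {ae P, forall x, (Z x <= (Psi_ins phi (avg_proc Xbar) x)%:E)%E}.
    have h7 : {ae P, forall x, Z x = avg_risk P F t TT phi X a0 x}.
      by apply: filterS2 h2 worst => x <- ->.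
    have h8 : {ae P, forall x, avg_risk P F t TT phi X a0 x =
        ((pairing P F t TT (avg_proc Xbar) a0 x)%:E + phi_sharp P F t TT phi a0 x)%E}.
      apply: filterS2 h4 h5 => x h4 h5; rewrite /avg_risk h4; congr (_ + _)%E.
      by rewrite EFinM -sumEFin; congr (_ * _)%E; apply: eq_bigr => i _; rewrite h5.
    by apply: filterS3 h7 h8 h3 => x -> ->.
  by apply: filterS2 h1 h6 => x; exact: le_trans.
by move=> Z' mZ' hZ'; apply: hZ'; exists Xbar.
Qed.
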